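(* Let $\mathfrak{U}$ be a character amenable Banach algebra. Then for each $\phi\in\Delta(\mathfrak{U})$ and each Banach $\mathfrak{U}$-bimodule $X$ such that either $x\cdot a=\phi(a)x$ for all $a\in\mathfrak{U}$, $x\in X$, or $a\cdot x=\phi(a)x$ for all $a\in\mathfrak{U}$, $x\in X$, and for every continuous Lie derivation $\delta:\mathfrak{U}\to X$, there exist a continuous derivation $d:\mathfrak{U}\to X$ and a continuous center-valued trace $\varphi:\mathfrak{U}\to\mathcal{Z}_{\mathfrak{U}}(X)$ such that $\delta=d+\varphi$.
   Context: Banach algebras are complex. $\Delta(\mathfrak{U})$ is the set of all non-zero multiplicative linear functionals on $\mathfrak{U}$. For a Banach $\mathfrak{U}$-bimodule $X$, the dual $X^*$ is a Banach $\mathfrak{U}$-bimodule via $\langle a\cdot f,x\rangle=\langle f,x\cdot a\rangle$ and $\langle f\cdot a,x\rangle=\langle f,a\cdot x\rangle$. A linear map $\delta:\mathfrak{U}\to X$ is a derivation if $\delta(ab)=\delta(a)\cdot b+a\cdot\delta(b)$ for all $a,b\in\mathfrak{U}$; it is inner if for some $x\in X$, $\delta(a)=a\cdot x-x\cdot a$ for all $a$. $H^1(\mathfrak{U},X)$ is the quotient of the space of continuous derivations $\mathfrak{U}\to X$ by the space of inner derivations. $\mathfrak{U}$ is character amenable if $H^1(\mathfrak{U},X^* )=\{0\}$ for all $\phi\in\Delta(\mathfrak{U})\cup\{0\}$ and all Banach $\mathfrak{U}$-bimodules $X$ such that either $x\cdot a=\phi(a)x$ for all $a\in\mathfrak{U},x\in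 X$, or $a\cdot x=\phi(a)x$ for all $a\in\mathfrak{U},x\in X$. The centre of $X$ is $\mathcal{Z}_{\mathfrak{U}}(X)=\{x\in X: a\cdot x=x\cdot a\text{ for all }a\in\mathfrak{U}\}$. A linear map $\delta:\mathfrak{U}\to X$ is a Lie derivation if $\delta([a,b])=[\delta(a),b]+[a,\delta(b)]$ for all $a,b\in\mathfrak{U}$, where $[a,b]=ab-ba$, $[a,x]=a\cdot x-x\cdot a$ and $[x,a]=x\cdot a-a\cdot x$ for $a,b\in\mathfrak{U}$, $x\in X$. A center-valued trace is a linear map $\varphi:\mathfrak{U}\to\mathcal{Z}_{\mathfrak{U}}(X)$ with $\varphi([a,b])=0$ for all $a,b\in\mathfrak{U}$. *)

(* Defs.v *)
From HB Require Import structures.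
From mathcomp Require Import all_boot all_order all_algebra.
From mathcomp Require Import complex.
From mathcomp Require Import boolp classical_sets functions reals.
From mathcomp Require Import topology normedtype.

Set Implicit Arguments.
Unset Strict Implicit.
Unset Printing Implicit Defensive.

Import Order.TTheory GRing.Theory Num.Theory.
Import numFieldNormedType.Exports.

Local Open Scope classical_set_scope.
Local Open Scope complex_scope.
Local Open Scope ring_scope.

Reserved Notation "a ** b" (at level 40, left associativity).
Reserved Notation "a *> x" (at level 40, left associativity).
Reserved Notation "x <* a" (at level 40, left associativity).

(* Not necessarily unital. As for any normed module over K = R[i], the norm
   takes its values in the nonnegative, hence real, elements of R[i]. *)
HB.mixin Record isBanachAlgebra (K : numFieldType) A
    of CompleteNormedModule K A := {
  bmul : A -> A -> A;
  bmulA : associative bmul;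
  bmulDl : left_distributive bmul +%R;
  bmulDr : right_distributive bmul +%R;
  bmulZl : forall (k : K) (a b : A), bmul (k *: a) b = k *: bmul a b;
  bmulZr : forall (k : K) (a b : A), bmul a (k *: b) = k *: bmul a b;
  bnormM : forall a b : A, `|bmul a b| <= `|a| * `|b|
}.

#[short(type="banachAlgType")]
HB.structure Definition BanachAlgebra (K : numFieldType) :=
  {A of CompleteNormedModule K A & isBanachAlgebra K A}.

Notation "a ** b" := (bmul a b) : ring_scope.

(* The actions are only required to be jointly bounded, with arbitrary
   constants; this is the usual joint continuity of bilinear maps. *)
HB.mixin Record isBanachBimodule (K : numFieldType) (U : banachAlgType K) X
    of CompleteNormedModule K X := {
  lact : U -> X -> X;
  ract : X -> U -> X;
  lactDl : forall a b x, lact (a + b) x = lact a x + lact b x;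
  lactDr : forall a x y, lact a (x + y) = lact a x + lact a y;
  lactZl : forall (k : K) a x, lact (k *: a) x = k *: lact a x;
  lactZr : forall (k : K) a x, lact a (k *: x) = k *: lact a x;
  ractDl : forall x y a, ract (x + y) a = ract x a + ract y a;
  ractDr : forall x a b, ract x (a + b) = ract x a + ract x b;
  ractZl : forall (k : K) x a, ract (k *: x) a = k *: ract x a;
  ractZr : forall (k : K) x a, ract x (k *: a) = k *: ract x a;
  lactA : forall a b x, lact (a ** b) x = lact a (lact b x);
  ractA : forall x a b, ract x (a ** b) = ract (ract x a) b;
  lractA : forall a x b, ract (lact a x) b = lact a (ract x b);
  lact_bounded : exists M : K, forall a x, `|lact a x| <= M * `|a| * `|x|;
  ract_bounded : exists M : K, forall x a, `|ract x a| <= M * `|x| * `|a|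
}.

#[short(type="banachBimodType")]
HB.structure Definition BanachBimodule (K : numFieldType) (U : banachAlgType K) :=
  {X of CompleteNormedModule K X & isBanachBimodule K U X}.

Notation "a *> x" := (lact a x) : ring_scope.
Notation "x <* a" := (ract x a) : ring_scope.

Section Dual.
Variables (R : realType) (X : normedModType R[i]).

Definition dual_pred : {pred X -> R[i]^o} :=
  [pred f : X -> R[i]^o | `[< linear f /\ continuous f >]].

Lemma dual_predP (f : X -> R[i]^o) :
  reflect (linear f /\ continuous f) (f \in dual_pred).
Proof. by rewrite unfold_in; exact: asboolP. Qed.

Lemma dual_submod : submod_closed dual_pred.
Proof.
split.
  apply/dual_predP; split; last by move=> x; exact: cvg_cst.
  by move=> k x y; apply/esym; rewrite [LHS]addr0; exact: scaler0.
move=> k f g /dual_predP[fl fc] /dual_predP[gl gc].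
apply/dual_predP; split.
  move=> c x y; rewrite -[LHS]/(k *: f (c *: x + y) + g (c *: x + y)).
  rewrite -[RHS]/(c *: (k *: f x + g x) + (k *: f y + g y)) fl gl !scalerDr !scalerA mulrC.
  by rewrite addrACA.
move=> x; apply: cvgD; last exact: gc.
by apply: cvgZr; exact: fc.
Qed.

HB.instance Definition _ :=
  GRing.isSubmodClosed.Build R[i] (X -> R[i]^o) dual_pred dual_submod.

Record dual := Dual { dual_fun :> X -> R[i]^o; _ : dual_fun \in dual_pred }.

HB.instance Definition _ := [isSub for dual_fun].
HB.instance Definition _ := [Choice of dual by <:].
HB.instance Definition _ := [SubChoice_isSubLmodule of dual by <:].

Lemma dual_linear (f : dual) : linear f.
Proof. by case: f => f /= /dual_predP[]. Qed.

HB.instance Definition _ (f : dual) :=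
  GRing.isLinear.Build R[i] X R[i]^o _ f (@dual_linear f).

Lemma dual_continuous (f : dual) : continuous f.
Proof. by case: f => f /= /dual_predP[]. Qed.

Lemma dualE (f g : dual) : (forall x, f x = g x) -> f = g.
Proof. by move=> fg; apply: val_inj; apply/funext. Qed.

Lemma dual_addE (f g : dual) x : (f + g) x = f x + g x.
Proof. by []. Qed.

Lemma dual_oppE (f : dual) x : (- f) x = - f x.
Proof. by []. Qed.

Lemma dual_scaleE (k : R[i]) (f : dual) x : (k *: f) x = k * f x.
Proof. by []. Qed.

(* The operator norm; Re is only a cast, since `|f x| is real. *)
Definition dual_norm (f : dual) : R[i] :=
  (sup [set complex.Re `|f x| | x in [set x : X | `|x| <= 1]])%:C.

End Dual.

Section BoundedLinear.
Variable K : numFieldType.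

Lemma le_mul_norm (M t s : K) : 0 <= t -> 0 <= s -> s <= M * t -> s <= `|M| * t.
Proof.
move=> t0 s0 sMt; rewrite -[t in leRHS]ger0_norm// -normrM ger0_norm//.
exact: le_trans sMt.
Qed.

Lemma bounded_continuous (V W : normedModType K) (f : V -> W) (M : K) :
  linear f -> (forall x, `|f x| <= M * `|x|) -> continuous f.
Proof.
move=> fl fM.
pose g : {linear V -> W} := HB.pack f (GRing.isLinear.Build K V W _ f fl).
have : continuous g; last by [].
apply: bounded_linear_continuous; apply/linear_boundedP.
near=> r => x; apply: (le_trans (le_mul_norm _ _ (fM x))) => //.
apply: ler_wpM2r => //; near: r; apply: nbhs_pinfty_ge.
exact: normr_real.
Unshelve. all: by end_near. Qed.

Lemma norm_cvg_le (V : normedModType K) (T : Type) (F : set_system T)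
    (FF : ProperFilter F) (u : T -> V) (y : V) (B : K) :
  u @ F --> y -> B \is Num.real -> (\forall t \near F, `|u t| <= B) -> `|y| <= B.
Proof.
move=> uy Br Fu; rewrite real_leNgt ?normr_real//; apply/negP => By.
have [t []] := filter_ex (filterI Fu (cvgr_norm_gt _ uy _ By)).
by move=> /le_lt_trans h /h; rewrite ltxx.
Qed.

End BoundedLinear.

Section ComplexComplete.
Variable R : realType.
Implicit Types (x y : R[i]).

Lemma le_Re x y : x <= y -> complex.Re x <= complex.Re y.
Proof. by rewrite lecE => /andP[]. Qed.

Lemma norm_Re_le x : `|complex.Re x|%:C <= `|x|.
Proof. exact: normc_ge_Re. Qed.

Lemma norm_i : `|'i%C : R[i]| = 1.
Proof. by rewrite normc_def/= expr0n/= add0r expr1n sqrtr1. Qed.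

Lemma norm_Im_le x : `|complex.Im x|%:C <= `|x|.
Proof. by have := normc_ge_Re (x * 'i%C); rewrite ReiNIm normrN normrM norm_i mulr1. Qed.

Lemma complex_complete (F : set_system R[i]^o) :
  ProperFilter F -> cauchy F -> cvg F.
Proof.
move=> FF /cauchy_ballP Fc.
have part (g : R[i]^o -> R) : (forall x y, g (x - y) = g x - g y) ->
    (forall x, `|g x|%:C <= `|x|) -> cvg (g @ F).
  move=> gB gle; apply: cauchy_cvg; apply/cauchy_exP => e e0.
  have /(Fc _) : 0 < e%:C by rewrite ltcR.
  move=> /nearP_dep Fe.
  have [x Fx] := filter_ex Fe; exists (g x).
  apply: filterS Fx => y; rewrite -!ball_normE /ball_/= => xy.
  by rewrite -ltcR -gB; apply: le_lt_trans (gle _) xy.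
have /cvg_ex[u Fu] := part _ (raddfB (@complex.Re R)) norm_Re_le.
have /cvg_ex[v Fv] := part _ (raddfB (@complex.Im R)) norm_Im_le.
apply/cvg_ex; exists (u +i* v : R[i]^o).
apply/cvgrPdist_le => e e0.
have eE : e = (complex.Re e)%:C by rewrite RRe_real ?gtr0_real.
move: e0; rewrite eE ltcR; move: (complex.Re e) => {eE}e e0.
have e20 : 0 < e / 2 by rewrite divr_gt0.
move/cvgrPdist_le: Fu => /(_ _ e20) Fu.
move/cvgrPdist_le: Fv => /(_ _ e20) Fv.
near=> z.
rewrite (_ : _ - z = (u - complex.Re z)%:C + 'i * (v - complex.Im z)%:C); last first.
  by rewrite [LHS]complexE; case: (z).
rewrite (le_trans (ler_normD _ _))// normrM norm_i mul1r.
rewrite [e]splitr !normc_def/= !expr0n/= !addr0 !sqrtr_sqr -rmorphD/= lecR.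
by apply: lerD; [near: z|near: z].
Unshelve. all: by end_near. Qed.

End ComplexComplete.

Section DualNorm.
Variables (R : realType) (X : normedModType R[i]).
Implicit Types f g : dual X.

Lemma dual_bounded f :
  exists2 M : R[i], 0 <= M & forall x, `|f x| <= M * `|x|.
Proof.
have := @continuous_linear_bounded _ _ _ 0 f (@dual_continuous _ _ f 0).
by move=> /linear_boundedP /pinfty_ex_gt0[M /ltW M0 fM]; exists M.
Qed.

Lemma dual_norm_has_sup f :
  has_sup [set complex.Re `|f x| | x in [set x : X | `|x| <= 1]].
Proof.
split; first by exists (complex.Re `|f 0|), 0 => //=; rewrite normr0.
have [M M0 fM] := dual_bounded f; exists (complex.Re M) => _ [x /= x1 <-].
by apply: (@le_Re _ `|f x| M); apply: (le_trans (fM x)); rewrite ler_piMr.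
Qed.

Let normCE (V : normedZmodType R[i]) (v : V) : `|v| = (complex.Re `|v|)%:C.
Proof. by rewrite RRe_real// normr_real. Qed.

Lemma dual_norm_ub f x : `|f x| <= dual_norm f * `|x|.
Proof.
have [->|x0] := eqVneq x 0; first by rewrite linear0 !normr0 mulr0.
have xgt0 : 0 < `|x| by rewrite normr_gt0.
rewrite -ler_pdivrMr// mulrC.
have -> : `|x|^-1 * `|f x| = `|f (`|x|^-1 *: x)|.
  by rewrite linearZ normrZ normfV normr_id.
rewrite normCE lecR; apply: ub_le_sup; first exact: (dual_norm_has_sup f).2.
by exists (`|x|^-1 *: x) => //=; rewrite normfZV.
Qed.

Lemma dual_norm_le f (M : R[i]) :
  0 <= M -> (forall x, `|f x| <= M * `|x|) -> dual_norm f <= M.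
Proof.
move=> M0 fM; rewrite -[M]RRe_real ?ger0_real// lecR.
apply: ge_sup; first exact: (dual_norm_has_sup f).1.
move=> _ [x /= x1 <-]; apply: (@le_Re _ `|f x| M); apply: (le_trans (fM x)).
by rewrite ler_piMr.
Qed.

Lemma dual_norm_ge0 f : 0 <= dual_norm f.
Proof.
rewrite ler0c; apply: ub_le_sup; first exact: (dual_norm_has_sup f).2.
by exists 0; [rewrite /= normr0|rewrite linear0 normr0].
Qed.

Lemma dual_normD f g : dual_norm (f + g) <= dual_norm f + dual_norm g.
Proof.
apply: dual_norm_le => [|x]; first by rewrite addr_ge0 ?dual_norm_ge0.
rewrite dual_addE mulrDl (le_trans (ler_normD _ _))//.
by rewrite lerD ?dual_norm_ub.
Qed.

Lemma dual_normZ (k : R[i]) f : dual_norm (k *: f) = `|k| * dual_norm f.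
Proof.
have le1 (l : R[i]) (h : dual X) : dual_norm (l *: h) <= `|l| * dual_norm h.
  apply: dual_norm_le => [|x]; first by rewrite mulr_ge0 ?dual_norm_ge0.
  by rewrite dual_scaleE normrM -mulrA ler_wpM2l ?dual_norm_ub.
apply/le_anti; rewrite le1/=.
have [->|k0] := eqVneq k 0; first by rewrite normr0 mul0r dual_norm_ge0.
rewrite -ler_pdivlMl ?normr_gt0// -normfV.
by rewrite -[f in leLHS](scalerK k0) le1.
Qed.

Lemma dual_norm0_eq0 f : dual_norm f = 0 -> f = 0.
Proof.
move=> f0; apply: dualE => x; apply/eqP; rewrite -normr_le0.
by have := dual_norm_ub f x; rewrite f0 mul0r.
Qed.

HB.instance Definition _ := Lmodule_isNormed.Build R[i] (dual X)
  dual_normD dual_normZ dual_norm0_eq0.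

Lemma dual_normE f : `|f| = dual_norm f.
Proof. by []. Qed.

Lemma dual_complete (F : set_system (dual X)) :
  ProperFilter F -> cauchy F -> cvg F.
Proof.
move=> FF /cauchy_ballP Fc.
have ev x : cvg ((fun f : dual X => f x : R[i]^o) @ F).
  apply: complex_complete; apply/cauchy_exP => e e0.
  have e'0 : 0 < e / (`|x| + 1) by rewrite divr_gt0 ?ltr_wpDl.
  have /nearP_dep/filter_ex[f Ff] := Fc _ e'0; exists (f x).
  apply: filterS Ff => g; rewrite -!ball_normE /ball_/= => fg.
  have := dual_norm_ub (f - g) x; rewrite dual_addE dual_oppE => /le_lt_trans; apply.
  move: fg; rewrite dual_normE ltr_pdivlMr ?ltr_wpDl// => /(le_lt_trans _); apply.
  by rewrite ler_wpM2l ?dual_norm_ge0// lerDl.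
have {ev} /choice[l Fl] : forall x, exists l : R[i]^o,
    (fun f : dual X => f x : R[i]^o) @ F --> l by move=> x; exact/cvg_ex.
have ll : linear l.
  move=> k x y.
  have : (fun f : dual X => f (k *: x + y) : R[i]^o) @ F --> k *: l x + l y.
    under eq_fun do rewrite linearP.
    by apply: cvgD (Fl y); apply: cvgZr; exact: Fl.
  move=> FD; exact: (cvg_unique (@norm_hausdorff _ _) (Fl _) FD).
have close (e : R[i]) : 0 < e ->
    \forall f \near F, forall x, `|l x - (f : dual X) x| <= e * `|x|.
  move=> e0; have := Fc _ e0; move=> /nearP_dep; apply: filterS => f Ff x.
  apply: (@norm_cvg_le _ R[i]^o _ F _ (fun g : dual X => g x - f x)).
  - by apply: cvgB; [exact: Fl|exact: cvg_cst].
  - by rewrite realM// gtr0_real.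
  - apply: filterS Ff => g; rewrite -ball_normE /ball_/= distrC => fg.
    apply: (le_trans (dual_norm_ub (g - f) x)).
    by rewrite ler_wpM2r// ltW.
have [f0 Hf0] := filter_ex (close _ (@ltr01 _)).
have [M M0 f0M] := dual_bounded f0.
have lP : l \in @dual_pred R X.
  apply/dual_predP; split => //; apply: (@bounded_continuous _ _ _ _ (1 + M)) => //.
  move=> x; rewrite -[l x](subrK (f0 x)) mulrDl.
  by rewrite (le_trans (ler_normD _ _))// lerD.
apply/cvg_ex; exists (Dual lP); apply/cvgrPdist_le => e e0.
apply: filterS (close _ e0) => f fe; apply: dual_norm_le => //; exact: ltW.
Qed.

HB.instance Definition _ := Uniform_isComplete.Build (dual X) dual_complete.

End DualNorm.

Section DualBimodule.
Variables (R : realType) (U : banachAlgType R[i]) (X : banachBimodType U).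

Lemma dual_lact_subproof (a : U) (f : dual X) :
  (fun x => f (x <* a)) \in @dual_pred R X.
Proof.
have [N N0 fN] := dual_bounded f; have [M rM] := @ract_bounded _ _ X.
apply/dual_predP.
have l : linear (fun x : X => f (x <* a)).
  by move=> k x y; rewrite ractDl ractZl linearP.
split=> //; apply: (@bounded_continuous _ _ _ _ (N * (`|M| * `|a|))) => // x.
apply: (le_trans (fN _)); rewrite -mulrA ler_wpM2l//.
rewrite mulrAC -mulrA; apply: le_mul_norm => //.
  by rewrite mulr_ge0.
by rewrite mulrA rM.
Qed.

Lemma dual_ract_subproof (f : dual X) (a : U) :
  (fun x => f (a *> x)) \in @dual_pred R X.
Proof.
have [N N0 fN] := dual_bounded f; have [M lM] := @lact_bounded _ _ X.
apply/dual_predP.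
have l : linear (fun x : X => f (a *> x)).
  by move=> k x y; rewrite lactDr lactZr linearP.
split=> //; apply: (@bounded_continuous _ _ _ _ (N * (`|M| * `|a|))) => // x.
apply: (le_trans (fN _)); rewrite -mulrA ler_wpM2l//.
rewrite -mulrA; apply: le_mul_norm => //.
  by rewrite mulr_ge0.
by rewrite mulrA lM.
Qed.

(* <a . f, x> = <f, x . a> and <f . a, x> = <f, a . x> *)
Definition dual_lact (a : U) (f : dual X) : dual X :=
  Dual (dual_lact_subproof a f).
Definition dual_ract (f : dual X) (a : U) : dual X :=
  Dual (dual_ract_subproof f a).

Lemma dual_lactDl a b f : dual_lact (a + b) f = dual_lact a f + dual_lact b f.
Proof. by apply: dualE => x; rewrite dual_addE /= ractDr linearD. Qed.
Lemma dual_lactDr a f g : dual_lact a (f + g) = dual_lact a f + dual_lact a g.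
Proof. by apply: dualE => x. Qed.
Lemma dual_lactZl (k : R[i]) a f : dual_lact (k *: a) f = k *: dual_lact a f.
Proof. by apply: dualE => x; rewrite dual_scaleE /= ractZr linearZ. Qed.
Lemma dual_lactZr (k : R[i]) a f : dual_lact a (k *: f) = k *: dual_lact a f.
Proof. by apply: dualE => x. Qed.
Lemma dual_ractDl f g a : dual_ract (f + g) a = dual_ract f a + dual_ract g a.
Proof. by apply: dualE => x. Qed.
Lemma dual_ractDr f a b : dual_ract f (a + b) = dual_ract f a + dual_ract f b.
Proof. by apply: dualE => x; rewrite dual_addE /= lactDl linearD. Qed.
Lemma dual_ractZl (k : R[i]) f a : dual_ract (k *: f) a = k *: dual_ract f a.
Proof. by apply: dualE => x. Qed.
Lemma dual_ractZr (k : R[i]) f a : dual_ract f (k *: a) = k *: dual_ract f a.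
Proof. by apply: dualE => x; rewrite dual_scaleE /= lactZl linearZ. Qed.
Lemma dual_lactA a b f : dual_lact (a ** b) f = dual_lact a (dual_lact b f).
Proof. by apply: dualE => x /=; rewrite ractA. Qed.
Lemma dual_ractA f a b : dual_ract f (a ** b) = dual_ract (dual_ract f a) b.
Proof. by apply: dualE => x /=; rewrite lactA. Qed.
Lemma dual_lractA a f b :
  dual_ract (dual_lact a f) b = dual_lact a (dual_ract f b).
Proof. by apply: dualE => x /=; rewrite lractA. Qed.

Lemma dual_lact_bounded :
  exists M : R[i], forall a f, `|dual_lact a f| <= M * `|a| * `|f|.
Proof.
have [M rM] := @ract_bounded _ _ X; exists `|M| => a f.
apply: dual_norm_le => [|x]; first by rewrite !mulr_ge0.
apply: (le_trans (dual_norm_ub f _)); rewrite -dual_normE.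
have -> : `|M| * `|a| * `|f| * `|x| = `|f| * (`|M| * (`|x| * `|a|)).
  by rewrite mulrAC mulrC -mulrA [`|a| * _]mulrC.
rewrite ler_wpM2l//; apply: le_mul_norm => //.
  by rewrite mulr_ge0.
by rewrite mulrA rM.
Qed.

Lemma dual_ract_bounded :
  exists M : R[i], forall f a, `|dual_ract f a| <= M * `|f| * `|a|.
Proof.
have [M lM] := @lact_bounded _ _ X; exists `|M| => f a.
apply: dual_norm_le => [|x]; first by rewrite !mulr_ge0.
apply: (le_trans (dual_norm_ub f _)); rewrite -dual_normE.
have -> : `|M| * `|f| * `|a| * `|x| = `|f| * (`|M| * (`|a| * `|x|)).
  by rewrite [`|M| * _]mulrC -!mulrA.
rewrite ler_wpM2l//; apply: le_mul_norm => //.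
  by rewrite mulr_ge0.
by rewrite mulrA lM.
Qed.

HB.instance Definition _ := isBanachBimodule.Build R[i] U (dual X)
  dual_lactDl dual_lactDr dual_lactZl dual_lactZr
  dual_ractDl dual_ractDr dual_ractZl dual_ractZr
  dual_lactA dual_ractA dual_lractA dual_lact_bounded dual_ract_bounded.

End DualBimodule.

Section Derivations.
Variables (K : numFieldType) (U : banachAlgType K).

Definition lie (a b : U) : U := a ** b - b ** a.

Section Bimodule.
Variable X : banachBimodType U.

Definition liel (a : U) (x : X) : X := a *> x - x <* a.
Definition lier (x : X) (a : U) : X := x <* a - a *> x.

Definition derivation (D : U -> X) :=
  linear D /\ forall a b, D (a ** b) = D a <* b + a *> D b.

Definition inner (D : U -> X) := exists x, forall a, D a = a *> x - x <* a.

(* The vanishing of H^1(U, X): the space of continuous derivations modulo the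
   (automatically continuous) inner derivations is trivial. *)
Definition H1_trivial :=
  forall D : U -> X, derivation D -> continuous D -> inner D.

Definition lie_derivation (D : U -> X) :=
  linear D /\ forall a b, D (lie a b) = lier (D a) b + liel a (D b).

Definition centre : set X := [set x | forall a : U, a *> x = x <* a].

Definition center_trace (T : U -> X) :=
  [/\ linear T, forall a, centre (T a) & forall a b, T (lie a b) = 0].

Definition one_sided (phi : U -> K) :=
  (forall (a : U) (x : X), x <* a = phi a *: x) \/
  (forall (a : U) (x : X), a *> x = phi a *: x).

End Bimodule.

(* Continuity is not required: it is automatic for multiplicative linear
   functionals on a Banach algebra. *)
Definition characters : set (U -> K) :=
  [set phi | [/\ scalar phi, {morph phi : a b / a ** b >-> a * b}
               & exists a, phi a != 0]].

End Derivations.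

Arguments characters {K} U _.
Arguments one_sided {K U} X phi.
Arguments H1_trivial {K U} X.

Definition character_amenable (R : realType) (U : banachAlgType R[i]) :=
  forall phi : U -> R[i], (characters U `|` [set cst 0]) phi ->
  forall X : banachBimodType U, one_sided X phi -> H1_trivial (dual X).

(* Main.v *)
(** For [phi] and a one-sided [X], put [a o b = ab - phi(a) b - phi(b) a] and
    [a . x = ax - phi(a) x], or their mirror images when it is the left action
    that is given by [phi]. Then [o] is associative with the same commutators
    as [U], the space [X] is a left [(U, o)]-module, and [delta] is a Lie
    derivation exactly when [T(a, b) = delta(a o b) - a . delta(b)] is symmetric.

    Character amenability yields functionals [M] on [U^*] with [M(phi) = 1] and
    [M(f(a -)) = phi(a) M(f)], and likewise on the other side. Helly's theorem
    turns them into bounded nets [m] in [U] with [phi(m) -> 1] and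
    [am - phi(a) m -> 0]. If [m'] is such a net for right multiplication, then
    [- m m'] is a two-sided bounded approximate identity of [(U, o)].

    The cocycle identity and the symmetry of [T] make the cyclic sum of
    [a . T(b, c)] vanish. Taking for [c] the approximate identity gives
    [c . T(a, b) = 0], so that [T(a o b, c) = T(a, b o c)], and
    [tau(a) = lim_u T(a, u)] exists, is central, and satisfies
    [tau(a o b) = T(a, b)]; hence [tau] is a trace and [delta - tau] is a
    derivation. *)
From HB Require Import structures.
Require Import Defs.
From mathcomp Require Import all_boot all_order all_algebra.
From mathcomp Require Import complex.
From mathcomp Require Import boolp classical_sets functions reals.
From mathcomp Require Import topology normedtype.
From mathcomp Require Import ring lra.

Set Implicit Arguments.
Unset Strict Implicit.
Unset Printing Implicit Defensive.

Import Order.TTheory GRing.Theory Num.Theory.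
Import numFieldNormedType.Exports.

Local Open Scope classical_set_scope.
Local Open Scope ring_scope.

(** * The theorems of Hahn-Banach and Helly *)

Section HahnBanach.
Variables (R : realType) (V : lmodType R[i]).
Implicit Types (p q : V -> R) (x y : V).

Definition sublinear p := (forall x y, p (x + y) <= p x + p y) /\
  (forall (t : R) x, 0 <= t -> p (t%:C%C *: x) <= t * p x).

Lemma sublinear0 p : sublinear p -> p 0 = 0.
Proof.
move=> [pD pZ]; apply/le_anti/andP; split.
  by have := pZ 0 0 (lexx _); rewrite mul0r scaler0.
by have := pD 0 0; rewrite addr0 lerDl.
Qed.

Lemma sublinearZ p (t : R) x : sublinear p -> 0 <= t -> p (t%:C%C *: x) = t * p x.
Proof.
move=> sp; rewrite le_eqVlt => /predU1P[<-|t0].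
  by rewrite scale0r mul0r sublinear0.
have tn0 : t%:C%C != 0 by rewrite gt_eqF// ltcR.
apply/le_anti; rewrite sp.2 ?(ltW t0)//= -ler_pdivlMl//.
by rewrite -[x in leLHS](scalerK tn0) -fmorphV sp.2// invr_ge0 ltW.
Qed.

Lemma sublinearN_ge p x : sublinear p -> - p (- x) <= p x.
Proof.
move=> sp; have := sp.1 x (- x).
by rewrite subrr sublinear0//; lra.
Qed.

(** The classical lowering of [p] in the direction [y]: it stays sublinear and below [p], and taking
    [t = 1] shows that its value at [- y] is at most [- p y]. *)
Definition slope p y x : R :=
  inf [set p (x + t%:C%C *: y) - t * p y | t in [set t | 0 <= t]].

(** Since [t * p y = p (t y) <= p (x + t y) + p (- x)], the infimum in [slope] is finite. *)
Lemma slope_lb p y x : sublinear p ->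
  lbound [set p (x + t%:C%C *: y) - t * p y | t in [set t | 0 <= t]] (- p (- x)).
Proof.
move=> sp _ [t /= t0 <-]; rewrite lerBrDr addrC -(sublinearZ y sp t0).
by rewrite lerBlDr (le_trans _ (sp.1 _ _))// addrAC subrr add0r.
Qed.

Lemma slope_le p y x (t : R) : sublinear p -> 0 <= t ->
  slope p y x <= p (x + t%:C%C *: y) - t * p y.
Proof.
by move=> sp t0; apply: ge_inf; [exists (- p (- x)); exact: slope_lb|exists t].
Qed.

Lemma le_slope p y x (b : R) : sublinear p ->
  (forall t, 0 <= t -> b <= p (x + t%:C%C *: y) - t * p y) -> b <= slope p y x.
Proof.
move=> sp h; apply: lb_le_inf; first by exists (p (x + 0%:C%C *: y) - 0 * p y), 0 => /=.
by move=> _ [t /= t0 <-]; exact: h.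
Qed.

Lemma slope_le_id p y x : sublinear p -> slope p y x <= p x.
Proof. by move=> /slope_le -/(_ y x 0 (lexx _)); rewrite scale0r addr0 mul0r subr0. Qed.

(** Parameters [t] for [x] and [t'] for [x'] combine to [t + t'] for [x + x'], and scaling by [s]
    turns [t] into [s * t]. *)
Lemma sublinear_slope p y : sublinear p -> sublinear (slope p y).
Proof.
move=> sp; split=> [x x'|s x].
  rewrite -lerBlDr; apply: le_slope => // t t0.
  rewrite lerBlDr -lerBlDl; apply: le_slope => // t' t'0.
  have /le_trans := slope_le y (x + x') sp (addr_ge0 t0 t'0).
  rewrite lerBlDl; apply.
  rewrite mulrDl opprD [X in _ <= X]addrACA addrA addrA lerD2r lerD2r.
  by rewrite rmorphD/= scalerDl addrACA; exact: sp.1.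
rewrite le_eqVlt => /predU1P[<-|s0].
  by rewrite mul0r scale0r (le_trans (slope_le_id _ _ sp))// sublinear0.
rewrite -ler_pdivrMl//; apply: le_slope => // t t0.
rewrite ler_pdivrMl// mulrBr mulrA -(sublinearZ _ sp (ltW s0)) scalerDr scalerA -rmorphM/=.
by apply: slope_le => //; rewrite mulr_ge0// ltW.
Qed.

(* A minimal sublinear functional [q] satisfies [q = slope q y] for every [y],
   which forces additivity. *)
Lemma hahn_banach_real p y : sublinear p -> exists g : V -> R,
  [/\ {morph g : u v / u + v}, (forall (t : R) x, g (t%:C%C *: x) = t * g x),
      (forall x, g x <= p x) & g y = p y].
Proof.
(* Minimality is sought below [slope p y] instead of [p]: the bound [- p y] at [- y] then forces
   [g y = p y]. *)
move=> sp; pose p' := slope p y.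
have sp' : sublinear p' by exact: sublinear_slope.
pose T := {q : V -> R | sublinear q /\ forall x, q x <= p' x}.
(* The order is reversed, so that a maximal element for Zorn is a minimal functional. *)
pose r (q1 q2 : T) := `[< forall x, sval q2 x <= sval q1 x >].
have [| | | |[q [sq qp']] qmin] := @Zorn T r.
- by move=> q; apply/asboolP.
- by move=> q1 q2 q3 /asboolP h12 /asboolP h23; apply/asboolP => x; apply: le_trans (h12 x).
- move=> [q1 h1] [q2 h2] /asboolP h12 /asboolP h21; apply: eq_exist.
  by apply/funext => x; apply/le_anti; rewrite h12 h21.
- move=> A Atot.
  have [[q0 Aq0]|A0] := pselect (exists q : T, A q); last first.
    by exists (exist _ p' (conj sp' (fun x => lexx _))) => q Aq; case: A0; exists q.
  pose E x := [set sval (q : T) x | q in A].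
  have E0 x : E x !=set0 by exists (sval q0 x), q0.
  have Elb x : has_lbound (E x).
    exists (- p' (- x)) => _ [q _ <-].
    rewrite (le_trans _ (sublinearN_ge x (svalP q).1))// lerN2; exact: (svalP q).2.
  pose m x := inf (E x).
  have mle (q : T) x : A q -> m x <= sval q x by move=> Aq; apply: ge_inf => //; exists q.
  have sm : sublinear m.
    split=> [x x'|t x t0].
      rewrite -lerBlDr; apply: lb_le_inf => // _ [q1 A1 <-].
      rewrite lerBlDr -lerBlDl; apply: lb_le_inf => // _ [q2 A2 <-]; rewrite lerBlDl.
      (* In a chain, the smaller of the two functionals bounds the infimum at [x + x']. *)
      have [/asboolP h|/asboolP h] := Atot _ _ A1 A2.
        by rewrite (le_trans (mle _ _ A2))// (le_trans ((svalP q2).1.1 _ _))// lerD2r.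
      by rewrite (le_trans (mle _ _ A1))// (le_trans ((svalP q1).1.1 _ _))// lerD2l.
    move: t0; rewrite le_eqVlt => /predU1P[<-|t0].
      by rewrite scale0r mul0r (le_trans (mle _ _ Aq0))// sublinear0//; exact: (svalP q0).1.
    rewrite -ler_pdivrMl//; apply: lb_le_inf => // _ [q Aq <-]; rewrite ler_pdivrMl//.
    by rewrite (le_trans (mle _ _ Aq))//; apply: (svalP q).1.2; rewrite ltW.
  have mp' x : m x <= p' x by apply: le_trans (mle _ _ Aq0) _; exact: (svalP q0).2.
  by exists (exist _ m (conj sm mp')) => q Aq; apply/asboolP => x /=; exact: mle.
have slopeq z x : slope q z x = q x.
  have h : sublinear (slope q z) /\ forall x, slope q z x <= p' x.
    split; first exact: sublinear_slope.
    by move=> u; rewrite (le_trans (slope_le_id _ _ sq)).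
  apply: (congr1 (fun q' : T => sval q' x) (qmin (exist _ _ h) _)).
  by apply/asboolP => u /=; exact: slope_le_id.
have qD : {morph q : u v / u + v}.
  move=> u v; apply/le_anti; rewrite sq.1/=.
  have := slope_le v u sq ler01; rewrite slopeq scale1r mul1r.
  by rewrite lerBrDr.
have qN x : q (- x) = - q x.
  by apply/eqP; rewrite -addr_eq0 -qD addrC subrr sublinear0.
have qp x : q x <= p x by rewrite (le_trans (qp' x))// slope_le_id.
exists q; split=> //.
  move=> t x; have [t0|t0] := leP 0 t; first exact: sublinearZ.
  have := sublinearZ (- x) sq (ltW (_ : 0 < - t)); rewrite oppr_gt0 => /(_ t0).
  by rewrite rmorphN scaleNr scalerN opprK qN mulrNN.
apply/le_anti; rewrite qp/= -lerN2 -qN (le_trans (qp' _))//.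
have := slope_le y (- y) sp ler01; rewrite scale1r mul1r => /le_trans; apply.
by rewrite addNr sublinear0// sub0r.
Qed.

Definition seminorm p := (forall x y, p (x + y) <= p x + p y) /\
  (forall (k : R[i]) x, p (k *: x) <= complex.Re `|k| * p x).

(** The real functional [g] is the real part of the complex-linear [g x - i g (i x)]. Rotating [x]
    by a unimodular scalar that makes [f x] nonnegative turns the bound on [g] into one on the
    modulus. *)
Lemma hahn_banach p y : seminorm p -> exists f : V -> R[i],
  [/\ scalar f, forall x, `|f x| <= (p x)%:C%C & `|f y| = (p y)%:C%C].
Proof.
move=> [pD pZ].
have sp : sublinear p.
  split=> // t x t0; rewrite (le_trans (pZ _ _))//.
  by rewrite normc_def/= expr0n/= addr0 sqrtr_sqr ger0_norm.
have [g [gD gZ gp gy]] := hahn_banach_real y sp.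
have g0 : g 0 = 0 by have := gZ 0 0; rewrite scaler0 mul0r.
have gN x : g (- x) = - g x by apply/eqP; rewrite -addr_eq0 -gD addrC subrr g0.
pose f x : R[i] := Complex (g x) (- g ('i%C *: x)).
have fl : scalar f.
  move=> [a b] x z; rewrite /f.
  have -> : Complex a b *: x = a%:C%C *: x + b%:C%C *: ('i%C *: x).
    rewrite scalerA -scalerDl; congr (_ *: _).
    by apply/eqP; rewrite eq_complex/=; apply/andP; split; apply/eqP; ring.
  rewrite !scalerDr !gD !scalerA.
  have -> : 'i%C * a%:C%C *: x = a%:C%C *: ('i%C *: x) by rewrite scalerA mulrC.
  have -> : 'i%C * (b%:C%C * 'i%C) *: x = - (b%:C%C *: x).
    by rewrite mulrCA -expr2 sqr_i mulrN1 scaleNr.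
  rewrite -scalerA !gN !gZ.
  by apply/eqP; rewrite eq_complex/=; apply/andP; split; apply/eqP; ring.
have fp x : `|f x| <= (p x)%:C%C.
  have [->|fx0] := eqVneq (f x) 0.
    rewrite normr0 ler0c.
    have := pZ 0 0; rewrite scaler0 normr0 mul0r => p0.
    have := pD x (- x); rewrite subrr -scaleN1r.
    have := pZ (-1) x; rewrite normrN1 mul1r.
    have := gp x; have := gp (- x); rewrite gN -scaleN1r.
    lra.
  pose k := `|f x| / f x.
  have k1 : `|k| = 1 by rewrite normrM normfV normr_id divff// normr_eq0.
  have fkx : f (k *: x) = `|f x|.
    have := fl k x 0; rewrite addr0 => ->.
    have -> : f 0 = 0 by rewrite /f scaler0 g0 oppr0.
    by rewrite addr0 /k mulfVK.
  rewrite -[`|f x|]RRe_real ?normr_real// lecR -fkx /=.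
  by rewrite (le_trans (gp _))// (le_trans (pZ _ _))// k1 mul1r.
exists f; split=> //.
apply/le_anti; rewrite fp/= -gy.
by rewrite (le_trans _ (norm_Re_le (f y)))// lecR/= ler_norm.
Qed.
End HahnBanach.

(** * Helly's theorem by infimal convolution *)

Section Helly.
Variable R : realType.

Lemma normCE (V : normedZmodType R[i]) (v : V) : `|v| = (complex.Re `|v|)%:C%C.
Proof. by rewrite RRe_real// normr_real. Qed.

Lemma seminorm_norm (U : normedModType R[i]) :
  seminorm (fun x : U => complex.Re `|x|).
Proof.
split=> [x y|k x]; first by rewrite -lecR rmorphD/= -!normCE ler_normD.
by rewrite -lecR rmorphM/= -!normCE normrZ.
Qed.

Lemma seminorm0 (V : lmodType R[i]) (p : V -> R) : seminorm p -> p 0 = 0.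
Proof.
move=> [pD pZ]; have := pZ 0 0; rewrite scaler0 normr0 mul0r => p0.
by apply/le_anti; rewrite p0; have := pD 0 0; rewrite addr0 lerDl.
Qed.

Lemma seminorm_ge0 (V : lmodType R[i]) (p : V -> R) x : seminorm p -> 0 <= p x.
Proof.
move=> sp; have := sp.1 x (- x); have := sp.2 (-1) x.
by rewrite subrr seminorm0// scaleN1r normrN1 mul1r; lra.
Qed.

Variables (U : normedModType R[i]) (W : lmodType R[i]) (q : W -> R).
Variables (A : {linear U -> W}) (N : R).
Hypotheses (sq : seminorm q) (N0 : 0 <= N).

(** The infimal convolution of [N * q] with the norm of [U] pushed forward along [A]. A functional
    dominated by it is dominated by [N * q], and its pullback along [A] has norm at most 1. *)
Definition infconv w : R := inf [set complex.Re `|m| + N * q (w - A m) | m in setT].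

Let val_ge0 w m : 0 <= complex.Re `|m| + N * q (w - A m).
Proof.
apply: addr_ge0; first exact: (seminorm_ge0 m (seminorm_norm U)).
by rewrite mulr_ge0// seminorm_ge0.
Qed.

Lemma infconv_le w m : infconv w <= complex.Re `|m| + N * q (w - A m).
Proof. by apply: ge_inf; [exists 0 => _ [n _ <-]|exists m]. Qed.

Lemma le_infconv w b :
  (forall m, b <= complex.Re `|m| + N * q (w - A m)) -> b <= infconv w.
Proof.
move=> h; apply: lb_le_inf; first by exists (complex.Re `|0 : U| + N * q (w - A 0)), 0.
by move=> _ [m _ <-]; exact: h.
Qed.

Lemma seminorm_infconv : seminorm infconv.
Proof.
split=> [x y|k x].
  rewrite -lerBlDr; apply: le_infconv => m.
  rewrite lerBlDr -lerBlDl; apply: le_infconv => m'; rewrite lerBlDl.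
  apply: (le_trans (infconv_le _ (m + m'))).
  rewrite addrACA -mulrDr lerD ?(seminorm_norm U).1// ler_wpM2l//.
  by rewrite linearD opprD addrACA sq.1.
have [->|k0] := eqVneq k 0.
  rewrite normr0 mul0r scale0r; apply: (le_trans (infconv_le _ 0)).
  by rewrite normr0 (linear0 A) subr0 (seminorm0 sq) mulr0 addr0.
have k0' : 0 < complex.Re `|k| by rewrite -ltcR -normCE normr_gt0.
rewrite -ler_pdivrMl//; apply: le_infconv => m; rewrite ler_pdivrMl//.
apply: (le_trans (infconv_le _ (k *: m))).
rewrite mulrDr lerD ?(seminorm_norm U).2// mulrCA ler_wpM2l//.
by rewrite linearZ/= -scalerBr sq.2.
Qed.

End Helly.

(** Hahn-Banach at [w] gives a functional whose modulus there equals [infconv q A N w]. The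
    hypothesis bounds it by [C], so some [m] makes the sum of the two terms less than [C + 1], hence
    each of them. *)
Lemma helly (R : realType) (U : normedModType R[i]) (W : lmodType R[i])
    (q : W -> R) (A : {linear U -> W}) (w : W) (C e : R) :
  seminorm q -> 0 <= C -> 0 < e ->
  (forall (f : W -> R[i]) (N : R), scalar f -> (forall x, `|f x| <= (N * q x)%:C%C) ->
     (forall m, `|f (A m)| <= `|m|) -> `|f w| <= C%:C%C) ->
  exists m, `|m| <= (C + 1)%:C%C /\ q (w - A m) <= e.
Proof.
(* With this weight, [N * q (w - A m) <= C + 1] becomes [q (w - A m) <= e]. *)
move=> sq C0 e0 H; pose N := (C + 1) / e.
have C1 : 0 < C + 1 by rewrite ltr_wpDl.
have N0 : 0 < N by rewrite divr_gt0.
have sp := seminorm_infconv A sq (ltW N0).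
have [f [fl fp fw]] := hahn_banach w sp.
have pw : infconv q A N w < C + 1.
  suff : `|f w| <= C%:C%C by rewrite fw lecR => /le_lt_trans -> //; rewrite ltrDl.
  apply: (H f N) => // [x|m]; rewrite (le_trans (fp _))//.
    rewrite lecR (le_trans (infconv_le A sq (ltW N0) x 0))//.
    by rewrite normr0 (linear0 A) subr0 add0r.
  rewrite [leRHS]normCE lecR (le_trans (infconv_le A sq (ltW N0) _ m))//.
  by rewrite subrr seminorm0// mulr0 addr0.
have [|_ [m _ <-] mC] := inf_lt _ pw.
  by exists (complex.Re `|0 : U| + N * q (w - A 0)), 0.
have m0 : 0 <= complex.Re `|m| by exact: (seminorm_ge0 m (seminorm_norm U)).
have q0 : 0 <= q (w - A m) by exact: seminorm_ge0.
exists m; split.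
  rewrite normCE lecR ltW// (le_lt_trans _ mC)// lerDl mulr_ge0// ltW//.
have : N * q (w - A m) <= C + 1 by rewrite ltW// (le_lt_trans _ mC)// lerDr.
by rewrite mulrC -ler_pdivlMr// /N invf_div mulrCA divff ?mulr1// gt_eqF.
Qed.

(** * From functionals on the dual to approximating elements *)

Section Approximation.
Variables (R : realType) (U : normedModType R[i]).

Lemma bounded_dual (f : U -> R[i]) (M : R[i]) :
  scalar f -> (forall x, `|f x| <= M * `|x|) -> exists g : dual U, forall x, g x = f x.
Proof.
move=> fl fM.
have fP : (f : U -> R[i]^o) \in @dual_pred R U.
  apply/dual_predP; split; first exact: fl.
  exact: (@bounded_continuous _ _ _ (f : U -> R[i]^o) _ fl fM).
by exists (Dual fP).
Qed.

Lemma dualZ (f : dual U) k x : f (k *: x) = k * f x.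
Proof. exact: linearZ. Qed.

Lemma dualN (f : dual U) x : f (- x) = - f x.
Proof. exact: linearN. Qed.

Lemma dualB (f : dual U) x y : f (x - y) = f x - f y.
Proof. exact: linearB. Qed.

Lemma dualP (f : dual U) k x y : f (k *: x + y) = k * f x + f y.
Proof. exact: linearP. Qed.

Variables (phi : dual U) (M : {linear dual U -> R[i]^o}) (C : R).
Hypotheses (C0 : 0 <= C) (MC : forall f, `|M f| <= C%:C%C * `|f|) (Mphi : M phi = 1).

(** Helly is applied to [m |-> (phi m, (A i m)_i)] and the target [(1, 0)]. A functional [f] on the
    product pulls back to [f (1, 0) *: phi] plus functionals factoring through the [A i], which [M]
    kills; so [f (1, 0)] is the value of [M] on the pullback, of modulus at most [C]. *)
Lemma approx_annihilated (n : nat) (A : 'I_n -> {linear U -> U}) (e : R) :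
  (forall i, exists B, forall x, `|A i x| <= B * `|x|) ->
  (forall i (f g : dual U), (forall x, g x = f (A i x)) -> M g = 0) ->
  0 < e ->
  exists m, [/\ `|m| <= (C + 1)%:C%C, `|phi m - 1| <= e%:C%C
    & forall i, `|A i m| <= e%:C%C].
Proof.
move=> AB AM e0; pose W := (R[i]^o * {ffun 'I_n -> U})%type.
pose q (v : W) : R := complex.Re `|v.1| + \sum_i complex.Re `|v.2 i|.
pose nU := seminorm_norm U; pose nC := seminorm_norm R[i]^o.
have q_ge0 (V : normedZmodType R[i]) (v : V) : 0 <= complex.Re `|v|.
  by have := normr_ge0 v; rewrite {1}normCE ler0c.
have sq : seminorm q.
  split=> [x y|k x].
    rewrite /q addrACA -big_split/= lerD ?nC.1// ler_sum// => i _.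
    by rewrite ffunE nU.1.
  rewrite /q mulrDr mulr_sumr lerD ?nC.2// ler_sum// => i _.
  by rewrite ffunE nU.2.
pose L (m : U) : W := (phi m, [ffun i => A i m]).
have Ll : linear L.
  move=> k x y; rewrite /L !linearP; congr (_, _).
  by apply/ffunP => i; rewrite !ffunE linearP.
pose L' : {linear U -> W} := HB.pack L (GRing.isLinear.Build R[i] U W _ L Ll).
have [|m [mC qm]] := @helly R U W q L' (1, 0) C e sq C0 e0; last first.
  exists m; split=> //.
    rewrite distrC normCE lecR (le_trans _ qm)// lerDl sumr_ge0// => i _; exact: q_ge0.
  move=> i; rewrite normCE lecR (le_trans _ qm)// /q (bigD1 i)//=.
  rewrite !ffunE sub0r normrN addrCA lerDl.
  by apply: addr_ge0; [exact: (q_ge0 _ (1 - phi m))|apply: sumr_ge0 => j _; exact: q_ge0].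
move=> f N fl fq fL.
have [h hE] : exists h : dual U, forall x, h x = f (L x).
  apply: (@bounded_dual _ 1) => [k x y|x]; last by rewrite mul1r; exact: fL.
  by rewrite Ll fl.
(* The insertions of the coordinates, used to split [f] into its components. *)
pose d i (x : U) : W := (0, [ffun j => if j == i then x else 0]).
have dl i : linear (d i).
  move=> k x y; rewrite /d; congr (_, _) => /=; first by rewrite scaler0 addr0.
  by apply/ffunP => j; rewrite !ffunE; case: ifP => // _; rewrite scaler0 addr0.
have qd i x : q (d i x) = complex.Re `|x|.
  rewrite /q (_ : `|(d i x).1| = 0); last exact: normr0.
  rewrite [complex.Re 0]/= add0r (bigD1 i)//= ffunE eqxx big1 ?addr0// => j /negPf ji.
  by rewrite ffunE ji normr0.
have fd i x : `|f (d i x)| <= N%:C%C * `|x|.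
  by rewrite [in leRHS]normCE -rmorphM/= -(qd i).
have g_ i : exists g : dual U, forall x, g x = f (d i (A i x)).
  have [B AB'] := AB i.
  have [g0 g0E] : exists g : dual U, forall x, g x = f (d i x).
    by apply: (@bounded_dual _ N%:C%C) => [k x y|x] //; rewrite dl fl.
  have [K K0 gK] := dual_bounded g0.
  apply: (@bounded_dual _ (K * B)) => [k x y|x]; first by rewrite linearP dl fl.
  by rewrite -g0E (le_trans (gK _))// -mulrA ler_wpM2l.
have {g_} /choice[g gE] := g_.
have Mg i : M (g i) = 0.
  have [g0 g0E] : exists g : dual U, forall x, g x = f (d i x).
    by apply: (@bounded_dual _ N%:C%C) => [k x y|x] //; rewrite dl fl.
  by apply: (AM i g0) => x; rewrite gE g0E.
pose f' : {linear W -> R[i]^o} := HB.pack f (GRing.isLinear.Build R[i] W R[i]^o _ f fl).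
have hd : h = f (1, 0) *: phi + \sum_i g i.
  apply: dualE => x; rewrite hE.
  have sumE : (\sum_i g i : dual U) x = \sum_i g i x.
    by elim/big_ind2: _ => // f1 z1 f2 z2 <- <-.
  rewrite dual_addE dual_scaleE sumE.
  have -> : L x = (phi x) *: ((1, 0) : W) + \sum_i d i (A i x).
    rewrite /L; apply/eqP; rewrite xpair_eqE; apply/andP; split; apply/eqP => /=.
      rewrite raddf_sum/= big1 ?addr0//; exact/esym/mulr1.
    rewrite scaler0 add0r raddf_sum/=; apply/ffunP => j; rewrite ffunE sum_ffunE.
    rewrite (bigD1 j)//= ffunE eqxx big1 ?addr0// => i /negPf ij.
    by rewrite ffunE eq_sym ij.
  rewrite fl mulrC; congr (_ + _).
  rewrite -[LHS]/(f' _) raddf_sum; apply: eq_bigr => i _; by rewrite gE.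
have -> : f (1, 0) = M h.
  rewrite hd linearD linearZ/= Mphi raddf_sum big1//= addr0.
  exact/esym/mulr1.
apply: (le_trans (MC h)); rewrite ler_piMr ?ler0c//.
by apply: dual_norm_le => // x; rewrite mul1r hE.
Qed.

End Approximation.

(** * Means on character amenable algebras *)

Section OneSided.
Variables (K : numFieldType) (U : banachAlgType K).

(** Passing to the opposite product for [s = true] lets the two one-sided cases share one
    argument. *)
Definition sided_mul (s : bool) (a b : U) : U := if s then b ** a else a ** b.

Lemma sided_mulA s : associative (sided_mul s).
Proof. by case: s => a b c; rewrite /sided_mul/= bmulA. Qed.

Lemma sided_mulDr s a b c : sided_mul s a (b + c) = sided_mul s a b + sided_mul s a c.
Proof. by case: s; rewrite /sided_mul ?bmulDl ?bmulDr. Qed.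

Lemma sided_mulDl s a b c : sided_mul s (a + b) c = sided_mul s a c + sided_mul s b c.
Proof. by case: s; rewrite /sided_mul ?bmulDl ?bmulDr. Qed.

Lemma sided_mulZr s k a b : sided_mul s a (k *: b) = k *: sided_mul s a b.
Proof. by case: s; rewrite /sided_mul ?bmulZl ?bmulZr. Qed.

Lemma sided_mulZl s k a b : sided_mul s (k *: a) b = k *: sided_mul s a b.
Proof. by case: s; rewrite /sided_mul ?bmulZl ?bmulZr. Qed.

Lemma sided_mulBr s a b c : sided_mul s a (b - c) = sided_mul s a b - sided_mul s a c.
Proof. by rewrite -scaleN1r sided_mulDr sided_mulZr scaleN1r. Qed.

Lemma sided_mulBl s a b c : sided_mul s (a - b) c = sided_mul s a c - sided_mul s b c.
Proof. by rewrite -scaleN1r sided_mulDl sided_mulZl scaleN1r. Qed.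

Lemma norm_sided_mul s a b : `|sided_mul s a b| <= `|a| * `|b|.
Proof. by case: s; rewrite /sided_mul; [rewrite mulrC|]; exact: bnormM. Qed.

End OneSided.

(* The dual of [U] with one action through [phi] and the other one transposing
   the multiplication of [U], corrected by a multiple of [phi] so that it takes
   values in the functionals vanishing at [e]. It has the same effect as the
   customary quotient of [U^*] by the line of [phi]. *)
Definition mean_module (R : realType) (U : banachAlgType R[i]) (s : bool)
  (phi : dual U) (e : U) (phiM : {morph phi : a b / a ** b >-> a * b})
  (phie : phi e = 1) : Type := dual U.

Section MeanModule.
Variables (R : realType) (U : banachAlgType R[i]) (s : bool) (phi : dual U) (e : U).
Variables (phiM : {morph phi : a b / a ** b >-> a * b}) (phie : phi e = 1).

Local Notation op := (@sided_mul _ U s).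
Local Notation Y := (mean_module s phiM phie).

HB.instance Definition _ := CompleteNormedModule.copy Y (dual U).

Lemma phi_op a b : phi (op a b) = phi a * phi b.
Proof. by rewrite /sided_mul; case: s; rewrite phiM// mulrC. Qed.

Lemma transpose_subproof (a : U) (f : dual U) :
  exists g : dual U, forall x, g x = f (op a x).
Proof.
have [M M0 fM] := dual_bounded f.
apply: (@bounded_dual _ _ _ (M * `|a|)) => [k x y|x].
  by rewrite sided_mulDr sided_mulZr linearP.
by rewrite (le_trans (fM _))// -mulrA ler_wpM2l// norm_sided_mul.
Qed.

Definition transpose a f := sval (cid (transpose_subproof a f)).

Lemma transposeE a f x : transpose a f x = f (op a x).
Proof. exact: (svalP (cid (transpose_subproof a f))). Qed.

(** As [phi e = 1], this is the projection along [phi] onto the functionals that kill [e]. *)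
Definition vanish (f : dual U) : dual U := f - f e *: phi.

Lemma vanishE f x : vanish f x = f x - f e * phi x.
Proof. by rewrite /vanish dual_addE dual_oppE dual_scaleE. Qed.

Definition mact (a : U) (f : dual U) : dual U := vanish (transpose a f).

Lemma mactE a f x : mact a f x = f (op a x) - f (op a e) * phi x.
Proof. by rewrite vanishE !transposeE. Qed.

Lemma mactDl a b f : mact (a + b) f = mact a f + mact b f.
Proof. by apply: dualE => x; rewrite dual_addE !mactE !sided_mulDl !linearD/=; ring. Qed.

Lemma mactDr a f g : mact a (f + g) = mact a f + mact a g.
Proof. by apply: dualE => x; rewrite dual_addE !mactE !dual_addE; ring. Qed.

Lemma mactZl k a f : mact (k *: a) f = k *: mact a f.
Proof. by apply: dualE => x; rewrite dual_scaleE !mactE !sided_mulZl !dualZ; ring. Qed.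

Lemma mactZr k a f : mact a (k *: f) = k *: mact a f.
Proof. by apply: dualE => x; rewrite dual_scaleE !mactE !dual_scaleE; ring. Qed.

(** Transposition reverses products. The inner multiple of [phi] disappears because transposition
    preserves the line of [phi], which [vanish] kills. *)
Lemma mactA a b f : mact (op b a) f = mact a (mact b f).
Proof.
by apply: dualE => x; rewrite !mactE !sided_mulA !phi_op phie; ring.
Qed.

Lemma mact_bounded : exists M : R[i], forall a f, `|mact a f| <= M * `|a| * `|f|.
Proof.
exists (1 + `|e| * `|phi|) => a f.
have M0 : 0 <= 1 + `|e| * `|phi| by rewrite addr_ge0// mulr_ge0.
apply: dual_norm_le => [|x]; first by rewrite !mulr_ge0.
rewrite mactE (le_trans (ler_normB _ _))//.
have h y : `|f (op a y)| <= `|f| * (`|a| * `|y|).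
  apply: (le_trans (dual_norm_ub f _)); rewrite -dual_normE ler_wpM2l//.
  exact: norm_sided_mul.
have hphi : `|phi x| <= `|phi| * `|x| by exact: dual_norm_ub.
have -> : (1 + `|e| * `|phi|) * `|a| * `|f| * `|x| =
   `|f| * (`|a| * `|x|) + (`|f| * (`|a| * `|e|)) * (`|phi| * `|x|) by ring.
by rewrite lerD// normrM ler_pM.
Qed.

(** By [mactA], transposing left multiplication ([s = false]) yields a right action and transposing
    right multiplication a left one; [phi] supplies the other side. *)
Definition ml (a : U) (f : Y) : Y := if s then mact a f else phi a *: f.
Definition mr (f : Y) (a : U) : Y := if s then phi a *: f else mact a f.

Lemma scale_bounded : exists M : R[i],
  forall (a : U) (f : Y), `|phi a *: f| <= M * `|a| * `|f|.
Proof.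
exists `|phi| => a f; rewrite normrZ ler_wpM2r//; exact: dual_norm_ub.
Qed.

Lemma mlDl a b x : ml (a + b) x = ml a x + ml b x.
Proof. by rewrite /ml; case: ifP => _; rewrite ?mactDl// linearD scalerDl. Qed.
Lemma mlDr a x y : ml a (x + y) = ml a x + ml a y.
Proof. by rewrite /ml; case: ifP => _; rewrite ?mactDr// scalerDr. Qed.
Lemma mlZl (k : R[i]) a x : ml (k *: a) x = k *: ml a x.
Proof. by rewrite /ml; case: ifP => _; rewrite ?mactZl// linearZ/= scalerA. Qed.
Lemma mlZr (k : R[i]) a x : ml a (k *: x) = k *: ml a x.
Proof. by rewrite /ml; case: ifP => _; rewrite ?mactZr// !scalerA mulrC. Qed.
Lemma mrDl x y a : mr (x + y) a = mr x a + mr y a.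
Proof. by rewrite /mr; case: ifP => _; rewrite ?mactDr// scalerDr. Qed.
Lemma mrDr x a b : mr x (a + b) = mr x a + mr x b.
Proof. by rewrite /mr; case: ifP => _; rewrite ?mactDl// linearD scalerDl. Qed.
Lemma mrZl (k : R[i]) x a : mr (k *: x) a = k *: mr x a.
Proof. by rewrite /mr; case: ifP => _; rewrite ?mactZr// !scalerA mulrC. Qed.
Lemma mrZr (k : R[i]) x a : mr x (k *: a) = k *: mr x a.
Proof. by rewrite /mr; case: ifP => _; rewrite ?mactZl// linearZ/= scalerA. Qed.
Lemma mlA a b x : ml (a ** b) x = ml a (ml b x).
Proof.
rewrite /ml; case: ifP => s1; last by rewrite phiM scalerA.
by rewrite -mactA /sided_mul s1.
Qed.
Lemma mrA x a b : mr x (a ** b) = mr (mr x a) b.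
Proof.
rewrite /mr; case: ifP => s1; first by rewrite phiM scalerA mulrC.
by rewrite -mactA /sided_mul s1.
Qed.
Lemma mlrA a x b : mr (ml a x) b = ml a (mr x b).
Proof.
by rewrite /ml /mr; case: s; [apply/esym; exact: mactZr|exact: mactZr].
Qed.
Lemma ml_bounded : exists M : R[i], forall a x, `|ml a x| <= M * `|a| * `|x|.
Proof. by rewrite /ml; case: s; [exact: mact_bounded|exact: scale_bounded]. Qed.
Lemma mr_bounded : exists M : R[i], forall x a, `|mr x a| <= M * `|x| * `|a|.
Proof.
have [M h] : exists M : R[i], forall a x, `|mr x a| <= M * `|a| * `|x|.
  by rewrite /mr; case: s; [exact: scale_bounded|exact: mact_bounded].
by exists M => x a; rewrite mulrAC.
Qed.

HB.instance Definition _ := isBanachBimodule.Build R[i] U Y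
  mlDl mlDr mlZl mlZr mrDl mrDr mrZl mrZr mlA mrA mlrA ml_bounded mr_bounded.

Lemma mean_module_one_sided : one_sided Y phi.
Proof.
rewrite /one_sided; case: (boolP s) => sE; [left|right] => a x.
  by rewrite -[LHS]/(mr x a) /mr sE.
by rewrite -[LHS]/(ml a x) /ml (negPf sE).
Qed.

End MeanModule.

(** * Invariant means from vanishing cohomology *)

Section MeanExistence.
Variables (R : realType) (U : banachAlgType R[i]) (s : bool) (phi : dual U) (e : U).
Hypotheses (phiM : {morph phi : a b / a ** b >-> a * b}) (phie : phi e = 1).

Local Notation op := (@sided_mul _ U s).
Local Notation Y := (mean_module s phiM phie).

(** Up to sign, this is the value at [a] of the inner derivation that evaluation at [e] would
    implement if [mact] were the plain [transpose]. *)
Lemma mean_der_subproof (a : U) : exists h : dual Y,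
  forall f : dual U, h f = f e * phi a - f (op a e).
Proof.
have bd (f : dual U) :
    `|f e * phi a - f (op a e)| <= (`|e| * `|phi a| + `|op a e|) * `|f|.
  rewrite (le_trans (ler_normB _ _))// mulrDl normrM lerD//.
    by rewrite mulrAC ler_wpM2r// mulrC; exact: dual_norm_ub.
  by rewrite mulrC; exact: dual_norm_ub.
apply: (@bounded_dual _ Y (fun f : dual U => f e * phi a - f (op a e)) _ _ bd).
by move=> k f g; rewrite !dual_addE !dual_scaleE; ring.
Qed.

Definition mean_der a : dual Y := sval (cid (mean_der_subproof a)).

Lemma mean_derE a (f : dual U) : mean_der a f = f e * phi a - f (op a e).
Proof. exact: (svalP (cid (mean_der_subproof a))). Qed.

Lemma mean_der_linear : linear mean_der.
Proof.
move=> k a b; apply: dualE => f; rewrite dual_addE dual_scaleE !mean_derE.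
by rewrite sided_mulDl sided_mulZl !dualP; ring.
Qed.

Lemma mean_der_continuous : continuous mean_der.
Proof.
apply: (@bounded_continuous _ _ _ _ (`|e| * `|phi| + `|e|)) => [|a].
  exact: mean_der_linear.
apply: dual_norm_le => [|f]; first by rewrite mulr_ge0// addr_ge0// mulr_ge0.
rewrite mean_derE (le_trans (ler_normB _ _))//.
have hphi : `|phi a| <= `|phi| * `|a| by exact: dual_norm_ub.
have he : `|(f : dual U) e| <= `|f| * `|e| by exact: (dual_norm_ub (f : dual U)).
have hae : `|(f : dual U) (op a e)| <= `|f| * (`|a| * `|e|).
  apply: (le_trans (dual_norm_ub (f : dual U) _)); rewrite -dual_normE ler_wpM2l//.
  exact: norm_sided_mul.
have -> : (`|e| * `|phi| + `|e|) * `|a| * `|f| =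
   (`|f| * `|e|) * (`|phi| * `|a|) + `|f| * (`|a| * `|e|) by ring.
by rewrite lerD// normrM ler_pM.
Qed.

Lemma mean_der_derivation : derivation mean_der.
Proof.
split; first exact: mean_der_linear.
move=> a b; apply: dualE => f; rewrite dual_addE.
rewrite -[(mean_der a <* b) f]/(mean_der a (ml b f)).
rewrite -[(a *> mean_der b) f]/(mean_der b (mr f a)).
rewrite /ml /mr; case sE: s.
  rewrite !mean_derE !dual_scaleE !mactE /sided_mul sE phiM phie !bmulA.
  by rewrite !phiM phie; ring.
rewrite !mean_derE !dual_scaleE !mactE /sided_mul sE !phiM phie !bmulA.
by ring.
Qed.

(** Amenability makes [mean_der] inner. Subtracting the implementing functional, composed with
    [vanish], from evaluation at [e] cancels the defect of invariance; since [vanish] kills [phi],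
    the value at [phi] remains [phi e = 1]. *)
Lemma mean_exists : character_amenable U ->
  exists (M : {linear dual U -> R[i]^o}) (C : R), [/\ 0 <= C,
    forall f, `|M f| <= C%:C%C * `|f|, M phi = 1 &
    forall a (f g : dual U), (forall x, g x = f (op a x)) -> M g = phi a * M f].
Proof.
move=> hU.
have hphi : (characters U `|` [set cst 0]) phi.
  left; split=> //; first by move=> k x y; rewrite linearP.
  by exists e; rewrite phie oner_neq0.
have [N NE] := hU _ hphi Y (mean_module_one_sided s phiM phie) _
  mean_der_derivation mean_der_continuous.
(* The flag [s] decides on which side [mact] acts, hence the sign in the inner derivation. *)
pose N' : dual Y := if s then N else - N.
have N'E a (f : dual U) : mean_der a f = phi a * N' f - N' (mact s phi e a f).
  rewrite NE dual_addE dual_oppE.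
  rewrite -[(a *> N) f]/(N (mr f a)) -[(N <* a) f]/(N (ml a f)).
  rewrite /N' /ml /mr; case: s; first by rewrite [N (_ *: _)]dualZ.
  by rewrite [N (_ *: _)]dualZ !dual_oppE; ring.
pose M (f : dual U) : R[i]^o := f e - N' (vanish phi e f).
have Ml : linear M.
  move=> k f g; rewrite /M.
  have -> : vanish phi e (k *: f + g) = k *: vanish phi e f + vanish phi e g.
    by apply: dualE => x; rewrite !(vanishE, dual_addE, dual_scaleE); ring.
  rewrite -[RHS]/(k * (f e - N' (vanish phi e f)) + (g e - N' (vanish phi e g))).
  by rewrite [N' (_ + _)]dualP dual_addE dual_scaleE; ring.
pose M' : {linear dual U -> R[i]^o} :=
  HB.pack M (GRing.isLinear.Build R[i] (dual U) R[i]^o _ M Ml).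
exists M'.
have [B B0 NB] := dual_bounded N'.
pose K : R[i] := `|e| + B * (1 + `|e| * `|phi|).
have K0 : 0 <= K by rewrite addr_ge0// mulr_ge0// addr_ge0// mulr_ge0.
exists (complex.Re K); split=> /=.
- by move: K0; rewrite lecE => /andP[].
- move=> f; rewrite (RRe_real (ger0_real K0)) /M.
  rewrite (le_trans (ler_normB _ _))// mulrDl lerD//.
    by rewrite mulrC; exact: dual_norm_ub.
  apply: le_trans (NB _) _; rewrite -mulrA ler_wpM2l//.
  rewrite (le_trans (ler_normB _ _))// mulrDl mul1r lerD// normrZ mulrAC ler_wpM2r//.
  by rewrite mulrC; exact: dual_norm_ub.
- have v0 : vanish phi e phi = 0.
    by apply: dualE => x; rewrite vanishE phie mul1r subrr.
  by rewrite /M v0 [N' 0]linear0 phie subr0.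
move=> a f g gE; rewrite /M.
have := N'E a (vanish phi e f).
(* [vanish] intertwines [transpose] with [mact]. *)
have -> : mact s phi e a (vanish phi e f) = vanish phi e g.
  apply: dualE => x; rewrite mactE !vanishE !gE !(phi_op s phiM) phie; ring.
rewrite mean_derE !vanishE (phi_op s phiM) phie gE => h.
have -> : N' (vanish phi e g) = phi a * N' (vanish phi e f) -
  ((f e - f e * 1) * phi a - (f (op a e) - f e * (phi a * 1))) by rewrite h; ring.
by ring.
Qed.

End MeanExistence.

Lemma cvg0_le (K : numFieldType) (T : Type) (F : set_system T) (FF : Filter F)
    (V W : normedModType K) (f : T -> V) (g : T -> W) (M : K) :
  f @ F --> (0 : V) -> (\forall t \near F, `|g t| <= M * `|f t|) -> g @ F --> (0 : W).
Proof.
move=> /cvgr0Pnorm_le f0 gM; apply/cvgr0Pnorm_le => e e0.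
have M0 : 0 < `|M| + 1 by rewrite ltr_wpDl.
have := f0 _ (divr_gt0 e0 M0); apply: filterS2 gM => t gf ft.
apply: (le_trans (le_mul_norm _ _ gf)) => //.
apply: (@le_trans _ _ ((`|M| + 1) * `|f t|)); first by rewrite ler_wpM2r// lerDl.
by rewrite mulrC -ler_pdivlMr.
Qed.

(** * A bounded approximate identity for the twisted product *)

Section ApproximateUnit.
Variables (R : realType) (U : banachAlgType R[i]) (phi : dual U) (e : U).
Hypotheses (phiM : {morph phi : a b / a ** b >-> a * b}) (phie : phi e = 1).
Hypothesis hU : character_amenable U.

(* If [U] had a unit 1, then [a |-> a - phi a *: 1] would carry [twist] to the
   product of [ker phi]. *)
Definition twist (a b : U) : U := a ** b - phi a *: b - phi b *: a.

Lemma bmulNr (a b : U) : a ** (- b) = - (a ** b).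
Proof. by rewrite -scaleN1r bmulZr scaleN1r. Qed.

Lemma bmulNl (a b : U) : (- a) ** b = - (a ** b).
Proof. by rewrite -scaleN1r bmulZl scaleN1r. Qed.

(** The net is encoded as a filter whose base is indexed by a finite list of elements and a
    tolerance. Base sets are inhabited because invariance says that the mean kills
    [x |-> f (sided_mul s a x - phi a *: x)]. *)
Lemma mean_filter s : exists (F : set_system U) (C : R[i]),
  [/\ ProperFilter F, \forall m \near F, `|m| <= C,
      (phi m : R[i]^o) @[m --> F] --> (1 : R[i]^o) &
      forall a, sided_mul s a m - phi a *: m @[m --> F] --> (0 : U)].
Proof.
have [M [C [C0 MC Mphi Ma]]] := mean_exists s phiM phie hU.
pose A a (m : U) := sided_mul s a m - phi a *: m.
have Al a : linear (A a).
  move=> k x y; rewrite /A sided_mulDr sided_mulZr scalerDr !scalerA scalerBr.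
  by rewrite opprD addrACA scalerA mulrC.
pose A' a : {linear U -> U} :=
  HB.pack (A a) (GRing.isLinear.Build R[i] U U _ (A a) (Al a)).
pose D := [set le : seq U * R | 0 < le.2].
pose B (le : seq U * R) := [set m : U | [/\ `|m| <= (C + 1)%:C%C,
  `|phi m - 1| <= le.2%:C%C & forall a, a \in le.1 -> `|A a m| <= le.2%:C%C]].
have BP : ProperFilter (filter_from D B).
  apply: filter_from_proper; last first.
    move=> [l d] /= d0.
    have [|||m [mC mphi mA]] := @approx_annihilated _ _ phi M C C0 MC Mphi (size l)
      (fun i => A' (nth 0 l i)) d.
    - move=> i; exists (`|nth 0 l i| + `|phi (nth 0 l i)|) => x /=.
      rewrite (le_trans (ler_normB _ _))// mulrDl normrZ lerD//.
      exact: norm_sided_mul.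
    - move=> i f g gE; set a := nth 0 l i in gE *.
      have [h hE] := transpose_subproof s a f.
      have -> : g = h - phi a *: f.
        apply: dualE => x; rewrite gE dual_addE dual_oppE dual_scaleE hE.
        by rewrite -dualZ -[RHS]/(f _ + - f _) -linearB.
      by rewrite linearB linearZ/= (Ma a f h hE) subrr.
    - by [].
    exists m; split=> // a al; have il : (index a l < size l)%N by rewrite index_mem.
    by have := mA (Ordinal il); rewrite /= nth_index.
  apply: filter_from_filter; first by exists ([::], 1); exact: ltr01.
  move=> [l1 d1] [l2 d2] /= d10 d20; exists (l1 ++ l2, Num.min d1 d2).
    by rewrite /D/= lt_min d10.
  move=> m [/= mC mphi mA]; split; split=> //=.
  - by rewrite (le_trans mphi)// lecR ge_min lexx.
  - by move=> a al; rewrite (le_trans (mA a _)) ?mem_cat ?al// lecR ge_min lexx.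
  - by rewrite (le_trans mphi)// lecR ge_min lexx orbT.
  - by move=> a al; rewrite (le_trans (mA a _)) ?mem_cat ?al ?orbT// lecR ge_min lexx orbT.
exists (filter_from D B), (C + 1)%:C%C; split=> //.
- by exists ([::], 1); [exact: ltr01|move=> m []].
- apply/cvgrPdist_le => d d0.
  have dE : d = (complex.Re d)%:C%C by rewrite RRe_real ?gtr0_real.
  exists ([::], complex.Re d); first by rewrite /D/= -ltcR -dE.
  by move=> m [_ /= + _]; rewrite distrC dE.
move=> a; apply/cvgr0Pnorm_le => d d0.
have dE : d = (complex.Re d)%:C%C by rewrite RRe_real ?gtr0_real.
exists ([:: a], complex.Re d); first by rewrite /D/= -ltcR -dE.
by move=> m [_ _ /= /(_ a)]; rewrite dE mem_seq1 eqxx; apply.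
Qed.

(** For [u = - m m'], [twist a u - a] equals [- (a m - phi(a) m) m' - (1 - phi(m) phi(m')) a], which
    is small as [m'] is bounded. For [twist u a] the factor [m' a - phi(a) m'] is small and [m] is
    bounded. *)
Lemma approx_unit : exists (F : set_system U) (C : R[i]),
  [/\ ProperFilter F, \forall u \near F, `|u| <= C,
      forall a, twist a u @[u --> F] --> a &
      forall a, twist u a @[u --> F] --> a].
Proof.
have [F1 [C1 [FF1 bd1 ph1 un1]]] := mean_filter false.
have [F2 [C2 [FF2 bd2 ph2 un2]]] := mean_filter true.
pose G := filter_prod F1 F2.
have bd1' : \forall p \near G, `|p.1| <= C1 by exact: (cvg_fst bd1).
have bd2' : \forall p \near G, `|p.2| <= C2 by exact: (cvg_snd bd2).
have ph (a : U) : (1 - phi p.1 * phi p.2) *: a @[p --> G] --> (0 : U).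
  have -> : (0 : U) = (1 - 1 * 1 : R[i]^o) *: a by rewrite mulr1 subrr scale0r.
  apply: cvgZr_tmp; apply: cvgB; first exact: cvg_cst.
  apply: (@cvgM R[i]).
    apply: (cvg_comp _ _ cvg_fst ph1).
  exact: (cvg_comp _ _ cvg_snd ph2).
pose v (p : U * U) := - (p.1 ** p.2).
exists (v @ G), (C1 * C2); split.
- exact: fmap_proper_filter.
- apply: filterS2 bd1' bd2' => p p1 p2 /=; rewrite normrN (le_trans (bnormM _ _))//.
  by rewrite ler_pM.
- move=> a; apply/subr_cvg0.
  suff : ((fun u => twist a u - a) \o v) @ G --> (0 : U) by [].
  have -> : (fun u => twist a u - a) \o v = fun p =>
      - ((a ** p.1 - phi a *: p.1) ** p.2) - (1 - phi p.1 * phi p.2) *: a.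
    apply/funext => p /=; rewrite /twist /v bmulNr dualN scaleNr phiM bmulA.
    rewrite bmulDl bmulNl bmulZl scalerBl scale1r scalerN !opprK !opprB.
    by rewrite [- _ + _ in LHS]addrC !addrA.
  have -> : (0 : U) = - 0 - 0 by rewrite oppr0 addr0.
  apply: cvgB => //; apply: cvgN.
  apply: (@cvg0_le _ _ _ _ _ _ (fun p => a ** p.1 - phi a *: p.1) _ C2).
    exact: (cvg_comp _ _ cvg_fst (un1 a)).
  apply: filterS bd2' => p p2; rewrite (le_trans (bnormM _ _))// mulrC ler_wpM2r//.
- move=> a; apply/subr_cvg0.
  suff : ((fun u => twist u a - a) \o v) @ G --> (0 : U) by [].
  have -> : (fun u => twist u a - a) \o v = fun p =>
      - (p.1 ** (p.2 ** a - phi a *: p.2)) - (1 - phi p.1 * phi p.2) *: a.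
    apply/funext => p /=; rewrite /twist /v bmulNl dualN scaleNr phiM -bmulA.
    rewrite bmulDr bmulNr bmulZr scalerBl scale1r scalerN !opprK !opprB.
    by rewrite [- _ + _ + _ in LHS]addrAC [- _ + _ in LHS]addrC !addrA.
  have -> : (0 : U) = - 0 - 0 by rewrite oppr0 addr0.
  apply: cvgB => //; apply: cvgN.
  apply: (@cvg0_le _ _ _ _ _ _ (fun p => p.2 ** a - phi a *: p.2) _ C1).
    exact: (cvg_comp _ _ cvg_snd (un2 a)).
  apply: filterS bd1' => p p1; rewrite (le_trans (bnormM _ _))// ler_wpM2r//.
Qed.

End ApproximateUnit.

(** * Symmetric cocycles and Lie derivations *)

Lemma continuous_cvg_comp (T : Type) (V W : topologicalType) (F : set_system T)
    {FF : Filter F} (h : V -> W) (f : T -> V) (a : V) :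
  continuous h -> f t @[t --> F] --> a -> h (f t) @[t --> F] --> h a.
Proof. by move=> hc fa; apply: continuous_cvg => //; exact: hc. Qed.

Section SymmetricCocycle.
Variables (K : numFieldType) (U : normedModType K) (X : completeNormedModType K).
Variables (circ : U -> U -> U) (star : U -> X -> X) (delta : U -> X).
Variables (N S B C : K) (F : set_system U).
Hypotheses
  (circA : associative circ)
  (circl : forall b, linear (circ ^~ b))
  (circ_bounded : forall a b, `|circ a b| <= N * `|a| * `|b|)
  (starl : forall x, linear (star ^~ x)) (starr : forall a, linear (star a))
  (starA : forall a b x, star (circ a b) x = star a (star b x))
  (star_bounded : forall a x, `|star a x| <= S * `|a| * `|x|)
  (deltal : linear delta) (delta_bounded : forall a, `|delta a| <= B * `|a|)
  (FF : ProperFilter F) (F_bounded : \forall u \near F, `|u| <= C)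
  (unitr : forall a, circ a u @[u --> F] --> a)
  (unitl : forall a, circ u a @[u --> F] --> a).

(** Up to sign, the Hochschild coboundary of [delta] for the left action [star] and the zero right
    action; whence [Tcocycle]. *)
Let T a b := delta (circ a b) - star a (delta b).

Hypothesis T_sym : forall a b, T a b = T b a.

Let star_cvg a : continuous (star a).
Proof. by apply: (@bounded_continuous _ _ _ _ (S * `|a|)) => // x. Qed.

Let starl_cvg x : continuous (star ^~ x).
Proof.
by apply: (@bounded_continuous _ _ _ _ (S * `|x|)) => // a; rewrite mulrAC.
Qed.

Let delta_cvg : continuous delta.
Proof. exact: (@bounded_continuous _ _ _ _ B). Qed.

Let Tl b : linear (T ^~ b).
Proof.
move=> k x y; rewrite /T (circl b) (starl (delta b)) deltal scalerBr.
by rewrite opprD addrACA.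
Qed.

Let T_bounded : exists2 M, 0 <= M & forall a b, `|T a b| <= M * `|a| * `|b|.
Proof.
exists (`|B| * `|N| + `|S| * `|B|); first by rewrite addr_ge0// mulr_ge0.
move=> a b; rewrite (le_trans (ler_normB _ _))// 2!mulrDl lerD//.
  apply: (le_trans (le_mul_norm _ _ (delta_bounded _))) => //.
  rewrite -!mulrA ler_wpM2l// le_mul_norm// ?mulr_ge0// mulrA//.
rewrite -mulrA; apply: (@le_trans _ _ (`|S| * (`|a| * `|delta b|))).
  by rewrite le_mul_norm ?mulr_ge0// mulrA.
rewrite -!mulrA ler_wpM2l// mulrCA ler_wpM2l// le_mul_norm//.
Qed.

(** Symmetry carries the linearity from the first argument to the second. *)
Let Tr a : linear (T a).
Proof. by move=> k x y; rewrite ![T a _]T_sym; exact: Tl. Qed.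

Let T_cvg a : continuous (T a).
Proof.
by have [M M0 TM] := T_bounded; apply: (@bounded_continuous _ _ _ _ (M * `|a|)).
Qed.

Let Tcocycle a b c : T (circ a b) c = T a (circ b c) + star a (T b c).
Proof. by rewrite /T (zmod_morphism_linear (starr a)) starA circA subrKA. Qed.

(** By the cocycle identity and symmetry each term is a difference of two values of [T], and the
    cyclic sum telescopes. *)
Let Tcyclic a b c : star a (T b c) + star b (T c a) + star c (T a b) = 0.
Proof.
have h x y z : star x (T y z) = T (circ x y) z - T (circ y z) x.
  by rewrite Tcocycle [T (circ y z) x]T_sym addrC addrA addNr add0r.
by rewrite !h !subrKA subrr.
Qed.

(* Put [c = u] in the cyclic identity and let [u] run along the approximate
   unit: the first two terms vanish in the limit. *)
Let star_T a b c : star c (T a b) = 0.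
Proof.
(* By symmetry [T y u = delta (circ u y) - star u (delta y)]; after applying [star x], both terms
   tend to [star x (delta y)]. *)
have lim0 x y : star x (T y u) @[u --> F] --> (0 : X).
  have -> : (fun u => star x (T y u)) =
      (fun u => star x (delta (circ u y)) - star (circ x u) (delta y)).
    by apply/funext => u; rewrite T_sym /T (zmod_morphism_linear (starr x)) starA.
  rewrite -(subrr (star x (delta y))); apply: cvgB.
    exact: (continuous_cvg_comp (@star_cvg x) (continuous_cvg_comp delta_cvg (@unitl y))).
  exact: (continuous_cvg_comp (@starl_cvg (delta y)) (@unitr x)).
have lim1 : star u (T a b) @[u --> F] --> (0 : X).
  have -> : (fun u => star u (T a b)) = (fun u => - star a (T b u) - star b (T a u)).
    apply/funext => u; rewrite -opprD; apply/eqP.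
    by rewrite -addr_eq0 addrC [T a u]T_sym Tcyclic.
  have -> : (0 : X) = - 0 - 0 by rewrite oppr0 addr0.
  by apply: cvgB => //; apply: cvgN.
(* Nothing makes [star u x] tend to [x], but [circ c u] tends to [c], so the limit is also
   [star c (T a b)]. *)
have lim2 : star (circ c u) (T a b) @[u --> F] --> (0 : X).
  under eq_fun do rewrite starA.
  have <- : star c 0 = 0.
    by rewrite -[0 in LHS](subrr 0) (zmod_morphism_linear (starr c)) subrr.
  exact: (continuous_cvg_comp (@star_cvg c) lim1).
apply: (cvg_unique (@norm_hausdorff _ _) _ lim2).
exact: (continuous_cvg_comp (@starl_cvg (T a b)) (@unitr c)).
Qed.

Let T_assoc a b c : T (circ a b) c = T a (circ b c).
Proof. by rewrite Tcocycle star_T addr0. Qed.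

(** Take [w] with [circ a w] close to [a]. By [T_assoc], [T a u] is close to
    [T (circ a w) u = T a (circ w u)], uniformly over bounded [u], and the latter tends to
    [T a w]. *)
Let T_cauchy a : cvg (T a u @[u --> F]).
Proof.
have [M M0 TM] := T_bounded.
apply: cauchy_cvg; apply: cauchy_exP => e e0.
have C0 : 0 <= C.
  by have [u uC] := filter_ex F_bounded; rewrite (le_trans _ uC).
have e20 : 0 < e / 2 by rewrite divr_gt0.
have MC : 0 < M * C + 1 by rewrite ltr_wpDl// mulr_ge0.
have /cvgrPdist_lt/(_ _ (divr_gt0 e20 MC)) := @unitr a.
move=> /filter_ex[w aw]; exists (T a w).
have : T a (circ w u) @[u --> F] --> T a w.
  exact: (continuous_cvg_comp (@T_cvg a) (@unitr w)).
move=> /cvgrPdist_lt/(_ _ e20) nw.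
suff : \forall u \near F, ball (T a w) e (T a u) by [].
near=> u; rewrite -ball_normE /ball_/=.
rewrite -[T a w](subrK (T a (circ w u))) -addrA (le_lt_trans (ler_normD _ _))//.
rewrite [e]splitr ltr_leD//; first by near: u.
rewrite -T_assoc -(zmod_morphism_linear (@Tl u)) (le_trans (TM _ _))// distrC.
have uC : `|u| <= C by near: u.
apply: (@le_trans _ _ ((M * C) * `|a - circ a w|)).
  by rewrite mulrAC ler_wpM2r// ler_wpM2l.
apply: (@le_trans _ _ ((M * C + 1) * `|a - circ a w|)).
  by rewrite ler_wpM2r// lerDl.
by rewrite mulrC -ler_pdivlMr// ltW.
Unshelve. all: by end_near. Qed.

(** [tau a] is the limit of [T a u]. The last identity is the limit of
    [T (circ a b) u = T a (circ b u)]. *)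
Lemma symmetric_cocycle : exists tau : U -> X,
  [/\ linear tau, continuous tau, forall a b, star b (tau a) = 0 &
      forall a b, tau (circ a b) = delta (circ a b) - star a (delta b)].
Proof.
have [M M0 TM] := T_bounded.
have /choice[tau tauE] : forall a, exists l : X, T a u @[u --> F] --> l.
  by move=> a; apply/cvg_ex; exact: T_cauchy.
have taul : linear tau.
  move=> k x y; apply: (cvg_unique (@norm_hausdorff _ _) (tauE _)).
  have -> : T (k *: x + y) = (fun u => k *: T x u + T y u).
    by apply/funext => u; exact: Tl.
  by apply: cvgD (tauE y); apply: cvgZr; exact: tauE.
exists tau; split=> //.
- apply: (@bounded_continuous _ _ _ _ (M * C)) => // a.
  have C0 : 0 <= C by have [u uC] := filter_ex F_bounded; rewrite (le_trans _ uC).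
  apply: (@norm_cvg_le _ _ _ F _ (T a)); [exact: tauE| |].
    by rewrite ger0_real// !mulr_ge0.
  apply: filterS F_bounded => u uC; rewrite (le_trans (TM _ _))// mulrAC.
  by rewrite ler_wpM2r// ler_wpM2l.
- move=> a b; have := continuous_cvg_comp (@star_cvg b) (tauE a).
  under eq_fun do rewrite star_T.
  by move=> h; apply: (cvg_unique (@norm_hausdorff _ _) (h _)); exact: cvg_cst.
move=> a b; apply: (cvg_unique (@norm_hausdorff _ _) (tauE _)).
have -> : T (circ a b) = (fun u => T a (circ b u)) by apply/funext => u; exact: T_assoc.
exact: (continuous_cvg_comp (@T_cvg a) (@unitr b)).
Qed.

End SymmetricCocycle.

(** On a nonzero vector [x] one of the bounded actions is multiplication by [phi a], so its bound
    passes to [phi]. *)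
Lemma one_sided_bounded (R : realType) (U : banachAlgType R[i])
    (phi : U -> R[i]) (X : banachBimodType U) (x : X) :
  one_sided X phi -> x != 0 -> exists M : R[i], forall a, `|phi a| <= M * `|a|.
Proof.
move=> hX x0; have xgt0 : 0 < `|x| by rewrite normr_gt0.
have [[M ML] [N NR]] := (@lact_bounded _ _ X, @ract_bounded _ _ X).
case: hX => h; [exists N|exists M] => a; rewrite -(ler_pM2r xgt0) -normrZ -h.
  by rewrite mulrAC.
exact: ML.
Qed.

(** * Splitting a Lie derivation over a character *)

Section LieDerivation.
Variables (R : realType) (U : banachAlgType R[i]) (phi : dual U) (e : U).
Hypotheses (phiM : {morph phi : a b / a ** b >-> a * b}) (phie : phi e = 1).
Hypothesis hU : character_amenable U.
Variables (X : banachBimodType U) (s : bool).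

(** [act s] is the unconstrained action. For [s = true] it is the right one, that is, a left action
    for the opposite product, in accordance with [sided_mul]. *)
Let act (t : bool) (a : U) (x : X) : X := if t then x <* a else a *> x.

Hypothesis actphi : forall a x, act (~~ s) a x = phi a *: x.

Variable delta : U -> X.
Hypotheses (hdelta : lie_derivation delta) (cdelta : continuous delta).

Let circ (a b : U) : U := sided_mul s a b - phi a *: b - phi b *: a.
Let star (a : U) (x : X) : X := act s a x - phi a *: x.

Let phi_sided a b : phi (sided_mul s a b) = phi a * phi b.
Proof. exact: phi_op. Qed.

(** The sign means that [- phi] is multiplicative for [circ]; it makes the [phi] terms match in
    [circA] and [starA]. *)
Let phi_circ a b : phi (circ a b) = - (phi a * phi b).
Proof. by rewrite /circ !dualB !dualZ phi_sided; ring. Qed.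

Let actDl t a b x : act t (a + b) x = act t a x + act t b x.
Proof. by rewrite /act; case: t; rewrite ?ractDr ?lactDl. Qed.

Let actDr t a x y : act t a (x + y) = act t a x + act t a y.
Proof. by rewrite /act; case: t; rewrite ?ractDl ?lactDr. Qed.

Let actZl t k a x : act t (k *: a) x = k *: act t a x.
Proof. by rewrite /act; case: t; rewrite ?ractZr ?lactZl. Qed.

Let actZr t k a x : act t a (k *: x) = k *: act t a x.
Proof. by rewrite /act; case: t; rewrite ?ractZl ?lactZr. Qed.

Let actBl t a b x : act t (a - b) x = act t a x - act t b x.
Proof. by rewrite -scaleN1r actDl actZl scaleN1r. Qed.

Let actBr t a x y : act t a (x - y) = act t a x - act t a y.
Proof. by rewrite -scaleN1r actDr actZr scaleN1r. Qed.

Let act_sided a b x : act s (sided_mul s a b) x = act s a (act s b x).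
Proof. by rewrite /act /sided_mul; case: s; rewrite ?ractA ?lactA. Qed.

Let act_bounded t : exists M : R[i], forall a x, `|act t a x| <= M * `|a| * `|x|.
Proof.
rewrite /act; case: t; last exact: lact_bounded.
by have [M h] := @ract_bounded _ _ X; exists M => a x; rewrite mulrAC.
Qed.

Let circA : associative circ.
Proof.
move=> a b c; rewrite /circ -/(circ a b) -/(circ b c) !phi_circ /circ.
rewrite !sided_mulBr !sided_mulBl !sided_mulZr !sided_mulZl sided_mulA !scaleNr !opprK.
rewrite !scalerBr !scalerA !opprB [phi c * phi b]mulrC [phi c * phi a]mulrC !addrA.
by rewrite [RHS](@GRing.add _).[ACl 1*3*7*6*4*2*5].
Qed.

Let starA a b x : star (circ a b) x = star a (star b x).
Proof.
rewrite /star phi_circ /circ !actBl !actBr !actZl actZr act_sided.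
rewrite !scalerBr !scalerA scaleNr opprK !opprB !addrA.
by rewrite [LHS](@GRing.add _).[ACl 1*3*4*2].
Qed.

Let circ_swap a b : circ a b - circ b a = sided_mul s a b - sided_mul s b a.
Proof.
rewrite /circ !opprB !addrA.
by rewrite [LHS](@GRing.add _).[ACl 1*6*2*5*3*4] addrK subrK.
Qed.

(** By [actphi], [star a x] is the commutator of [a] and [x] up to sign, so this is the Lie
    derivation identity rearranged through [circ_swap]. *)
Let T_sym a b :
  delta (circ a b) - star a (delta b) = delta (circ b a) - star b (delta a).
Proof.
apply/eqP; rewrite subr_eq addrAC -addrA addrC -subr_eq.
rewrite -(zmod_morphism_linear hdelta.1) circ_swap; apply/eqP.
move: actphi; rewrite /star /act /sided_mul; case: s => /= actp.
  rewrite -/(lie b a) hdelta.2 /lier /liel !actp.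
  by rewrite opprB.
rewrite -/(lie a b) hdelta.2 /lier /liel !actp.
by rewrite opprB addrC.
Qed.

Let lie_circ (f : U -> X) : linear f ->
  (forall a b, f (circ a b) = f (circ b a)) -> forall a b, f (lie a b) = 0.
Proof.
move=> fl h a b; have := circ_swap a b; have := circ_swap b a.
by rewrite /sided_mul /lie; case: s => [<- _|_ <-];
  rewrite (zmod_morphism_linear fl) h subrr.
Qed.

(** As [star] kills [tau], the difference [d] satisfies [d (circ a b) = star a (d b)]. Expanding
    cancels [phi a *: d b] and leaves the Leibniz rule, [phi b *: d a] being the scalar action.
    Centrality of [tau] is again [star b (tau a) = 0]. *)
Lemma lie_derivation_decomposition : exists d tau : U -> X,
    [/\ derivation d, continuous d, center_trace tau, continuous tau
      & delta = d \+ tau].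
Proof.
have [F [C [FF FC unr unl]]] := approx_unit phiM phie hU.
have [S SM] := act_bounded s.
have [B B0 deltaM] : exists2 M : R[i], 0 <= M & forall a, `|delta a| <= M * `|a|.
  pose delta' : {linear U -> X} :=
    HB.pack delta (GRing.isLinear.Build R[i] U X _ delta hdelta.1).
  have := @continuous_linear_bounded _ _ _ 0 delta' (@cdelta 0).
  by move=> /linear_boundedP /pinfty_ex_gt0[M /ltW M0 fM]; exists M.
have phiB a : `|phi a| <= `|phi| * `|a| by exact: dual_norm_ub.
have circM a b : `|circ a b| <= (1 + `|phi| + `|phi|) * `|a| * `|b|.
  rewrite (le_trans (ler_normB _ _))// -mulrA 2!mulrDl lerD//.
    rewrite (le_trans (ler_normB _ _))// mul1r lerD ?norm_sided_mul//.
    by rewrite normrZ mulrA ler_wpM2r.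
  by rewrite normrZ [`|a| * _]mulrC mulrA ler_wpM2r.
have starM a x : `|star a x| <= (S + `|phi|) * `|a| * `|x|.
  rewrite (le_trans (ler_normB _ _))// 2!mulrDl lerD//.
  by rewrite normrZ ler_wpM2r.
have circl b : linear (circ ^~ b).
  move=> k x y; rewrite /circ sided_mulDl sided_mulZl dualP scalerDl scalerDr.
  rewrite !scalerBr !scalerA !opprD !addrA [phi b * k]mulrC.
  by rewrite [LHS](@GRing.add _).[ACl 1*3*5*2*4*6].
have starl x : linear (star ^~ x).
  move=> k a b; rewrite /star actDl actZl dualP scalerDl.
  rewrite !scalerBr !scalerA !opprD !addrA.
  by rewrite [LHS](@GRing.add _).[ACl 1*3*2*4].
have starr a : linear (star a).
  move=> k x y; rewrite /star actDr actZr scalerDr.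
  rewrite !scalerBr !scalerA !opprD !addrA [phi a * k]mulrC.
  by rewrite [LHS](@GRing.add _).[ACl 1*3*2*4].
have circE a b : circ a b = if s then twist phi b a else twist phi a b.
  by rewrite /circ /twist /sided_mul; case: s; rewrite // addrAC.
have unr' a : circ a u @[u --> F] --> a.
  under eq_fun do rewrite circE.
  by case: s; [exact: unl|exact: unr].
have unl' a : circ u a @[u --> F] --> a.
  under eq_fun do rewrite circE.
  by case: s; [exact: unr|exact: unl].
have [tau [taul tauc tau0 tauE]] := symmetric_cocycle circA circl circM starl
  starr starA starM hdelta.1 deltaM FF FC unr' unl' T_sym.
pose d a := delta a - tau a.
have dl : linear d.
  by move=> k x y; rewrite /d hdelta.1 taul scalerBr opprD addrACA.
have dB := zmod_morphism_linear dl.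
have dZ k a : d (k *: a) = k *: d a := scalable_linear dl k a.
have dcirc a b : d (circ a b) = star a (d b).
  rewrite /d tauE opprB addrC subrK.
  by rewrite (zmod_morphism_linear (@starr a)) tau0 subr0.
have dE : delta = d \+ tau by apply/funext => a; rewrite /d /= subrK.
have dc : continuous d by move=> a; apply: cvgB; [exact: cdelta|exact: tauc].
clearbody d.
have dsided a b : d (sided_mul s a b) = act s a (d b) + phi b *: d a.
  have := dcirc a b; rewrite /circ /star !dB !dZ => /eqP.
  by rewrite subr_eq addrAC (inj_eq (addIr _)) => /eqP.
exists d, tau; split => //.
- split=> // a b.
  move: dsided actphi; rewrite /sided_mul /act; case: s => /= h actp.
    by rewrite h actp.
  by rewrite h actp addrC.
- split=> //.
    move=> a b; have /eqP := tau0 a b; rewrite subr_eq0 => /eqP.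
    by move: (actphi b (tau a)); rewrite /act; case: s => /= -> ->.
  by apply: lie_circ => // a b; rewrite !tauE T_sym.
Qed.

End LieDerivation.

Theorem corollary5p2 (R : realType) (U : banachAlgType R[i])
    (hU : character_amenable U)
    (phi : U -> R[i]) (hphi : characters U phi)
    (X : banachBimodType U) (hX : one_sided X phi)
    (delta : U -> X) (hdelta : lie_derivation delta)
    (cdelta : continuous delta) :
  exists d tau : U -> X,
    [/\ derivation d, continuous d, center_trace tau, continuous tau
      & delta = d \+ tau].
Proof.
(* The boundedness of [phi] is read off a nonzero vector, so the zero module is treated apart. *)
have [[x x0]|X0] := pselect (exists x : X, x != 0); last first.
  have X0' (x y : X) : x = y.
    suff h z : z = 0 :> X by rewrite [x]h [y]h.
    by apply/eqP/negPn/negP => z0; apply: X0; exists z.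
  exists delta, (cst 0); split=> //.
  - by split; [exact: hdelta.1|move=> a b; exact: X0'].
  - by split=> [k a b|a c|a b]; exact: X0'.
  - exact: cst_continuous.
  - by apply/funext => a; exact: X0'.
case: hphi => phil phiM [a0 phia0].
have [M phiB] := one_sided_bounded hX x0.
have [psi psiE] := bounded_dual phil phiB.
have psiM : {morph psi : a b / a ** b >-> a * b} by move=> a b; rewrite !psiE phiM.
have psie : psi ((phi a0)^-1 *: a0) = 1 by rewrite dualZ psiE mulVf.
have decomp := lie_derivation_decomposition psiM psie hU.
(* A right action through [phi] leaves the left one free, which is [s = false]. *)
by case: hX => h; [apply: (decomp X false)|apply: (decomp X true)] => // a y;
  rewrite /= h psiE.
Qed.
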